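(* Assume (A1)–(A5) of the context. Consider the system $$\frac{dq}{dt}=v-\Gamma_1\bigl(q+\mathcal C D\Psi(q)\bigr)+\sqrt{2\Gamma_1}\,\frac{dB_1}{dt},\qquad \frac{dv}{dt}=-\bigl(q+\mathcal C D\Psi(q)\bigr)-\Gamma_2 v+\sqrt{2\Gamma_2}\,\frac{dB_2}{dt}.$$ Then for any initial condition $(q(0),v(0))\in\mathcal H^s\times\mathcal H^s$, any $T>0$ and almost every $\mathcal H^s\times\mathcal H^s$-valued $\tilde{\mathfrak C}_s$-Brownian motion $\tilde B=(B_1,B_2)$, there exists a unique solution of the system in $C([0,T];\mathcal H^s\times\mathcal H^s)$. Furthermore, the Itô map $(B_1,B_2)\in C([0,T];\mathcal H^s\times\mathcal H^s)\mapsto(q,v)\in C([0,T];\mathcal H^s\times\mathcal H^s)$ is Lipschitz.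
   Context: Spaces. $(\mathcal H,\langle\cdot,\cdot\rangle,\|\cdot\|)$ is a separable real Hilbert space, $\mathcal C$ a positive trace class operator on $\mathcal H$ with $\mathcal C\varphi_j=\lambda_j^2\varphi_j$, $\{\varphi_j\}_{j\ge1}$ a complete orthonormal basis of $\mathcal H$; $x_j=\langle x,\varphi_j\rangle$. For $r\in\mathbb R$, $\mathcal H^r$ is the Hilbert space with $\langle x,y\rangle_r=\sum_j j^{2r}x_jy_j$, $\|x\|_r^2=\sum_j j^{2r}x_j^2$; $\mathcal H^{-s}$ is identified with the dual of $\mathcal H^s$ via $\langle\cdot,\cdot\rangle$. $\|(w_1,w_2)\|_{s\times s}^2=\|w_1\|_s^2+\|w_2\|_s^2$. The notation $\lesssim$ means inequality up to a multiplicative constant, and $\asymp$ means $\lesssim$ in both directions. Standing assumptions. (A1) There is $\kappa>\frac12$ with $\lambda_j\asymp j^{-\kappa}$. (A2) There is $s\in[0,\kappa-\frac12)$ such that $\Psi:\mathcal H^s\to\mathbb R$ is defined everywhere on $\mathcal H^s$. (A3) $0\le\Psi(x)\lesssim 1+\|x\|_s^2$. (A4) The first derivative $D\Psi(x)\in\mathcal H^{-s}$ and second derivative $\partial^2\Psi(x)\in\mathcal L(\mathcal H^s,\mathcal H^{-s})$ satisfy $\|D\Psi(x)\|_{-s}\lesssim1+\|x\|_s$ and $\|\partial^2\Psi(x)\|_{\mathcal L(\mathcal H^s,\mathcal H^{-s})}\lesssim1$ for all $x\in\mathcal H^s$. (A5) The operators $\Gamma_1,\Gamma_2$ commute with $\mathcal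 C$ and are bounded linear operators from $\mathcal H^s$ into itself. An $\mathcal H^s\times\mathcal H^s$-valued $\tilde{\mathfrak C}_s$-Brownian motion is a pair $(B_1,B_2)$ of independent processes, each of the form $\sum_j\lambda_j\beta_j(t)\varphi_j$ with $\beta_j$ i.i.d. standard real Brownian motions. A solution is a continuous path satisfying the time-integrated equation $x(t)=x(0)+\int_0^tG(x(u))\,du+\sqrt{2\Gamma}\,\tilde B(t)$ for $t\in[0,T]$, where $x=(q,v)$, $G(x)=\bigl(v-\Gamma_1(q+\mathcal C D\Psi(q)),\,-(q+\mathcal C D\Psi(q))-\Gamma_2v\bigr)$ and $\Gamma=\mathrm{diag}(\Gamma_1,\Gamma_2)$; the Itô map is the pathwise map (for the given initial condition) sending a driving path in $C([0,T];\mathcal H^s\times\mathcal H^s)$ to the solution of this integral equation. *)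

(* Defs.v *)
From HB Require Import structures.
From mathcomp Require Import all_boot all_order all_algebra.
From mathcomp Require Import all_classical all_reals all_analysis.
From mathcomp Require Import ring.

Set Implicit Arguments.
Unset Strict Implicit.
Unset Printing Implicit Defensive.

Import Order.TTheory GRing.Theory Num.Theory.
Import numFieldNormedType.Exports.

Local Open Scope classical_set_scope.
Local Open Scope ring_scope.

(* Sequences are indexed from 0: the index [j : nat] stands for j + 1, whence
   the [j.+1] in the weights. *)

(* A common setting for the spaces H^r: the coordinates of x : V are either the
   Fourier coefficients <x, phi_j> of a vector of a Hilbert space V, or the terms
   of a sequence. *)
Record coordinates (R : realType) (V : lmodType R) := Coordinates {
  coord :> V -> nat -> R ;
  coord_linear : forall (a : R) (x y : V) j,
    coord (a *: x + y) j = a * coord x j + coord y j ;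
  coord_eq0 : forall x : V, (forall j, coord x j = 0) -> x = 0 }.

Section SobolevScale.
Context {R : realType} {V : lmodType R} (c : coordinates V) (r : R).

(* |x|_r^2 = \sum_j j^(2r) x_j^2, and H^r = {x | |x|_r^2 < +oo}, which is then made
   a normed space for |.|_r. *)
Definition weight (j : nat) : R := (j.+1%:R : R) `^ (2 * r).

Definition sqnorm (x : V) : \bar R :=
  (\sum_(0 <= j <oo) (weight j * c x j ^+ 2)%:E)%E.

Definition finite_sqnorm : pred V := fun x => (sqnorm x < +oo)%E.

Record sobolev := Sobolev { sobolev_val :> V ; _ : finite_sqnorm sobolev_val }.

HB.instance Definition _ := [isSub for sobolev_val].
HB.instance Definition _ := [Choice of sobolev by <:].

Let t0 x j : (0 <= (weight j * c x j ^+ 2)%:E)%E.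
Proof. by rewrite lee_fin mulr_ge0 ?powR_ge0 ?sqr_ge0. Qed.

Lemma sqnorm_ge0 x : (0 <= sqnorm x)%E.
Proof. by apply: nneseries_ge0 => *; exact: t0. Qed.

Lemma coordD x y j : c (x + y) j = c x j + c y j.
Proof. by rewrite -[x]scale1r coord_linear mul1r scale1r. Qed.

Lemma coord0 j : c 0 j = 0.
Proof. by have := coord_linear c (-1) 0 0 j; rewrite scaleN1r addNr mulN1r addNr. Qed.

Lemma coordZ a x j : c (a *: x) j = a * c x j.
Proof. by rewrite -[a *: x]addr0 coord_linear coord0 addr0. Qed.

Lemma sqnorm0 : sqnorm 0 = 0%E.
Proof. by apply: eseries0 => j _ _; rewrite coord0 expr0n mulr0. Qed.

Lemma sqnormZ a x : sqnorm (a *: x) = ((a ^+ 2)%:E * sqnorm x)%E.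
Proof.
rewrite /sqnorm -nneseriesZl; last by move=> *; exact: t0.
by apply: eq_eseriesr => j _; rewrite coordZ exprMn -EFinM mulrCA.
Qed.

(* Optimizing over e gives the triangle inequality. *)
Lemma sqnorm_young e x y : 0 < e ->
  (sqnorm (x + y) <= (1 + e)%:E * sqnorm x + (1 + e^-1)%:E * sqnorm y)%E.
Proof.
move=> e0; rewrite /sqnorm -!nneseriesZl; [|by move=> *; exact: t0..].
have p1 : 0 <= 1 + e by rewrite addr_ge0// ltW.
have p2 : 0 <= 1 + e^-1 by rewrite addr_ge0// invr_ge0 ltW.
rewrite -nneseriesD; [|by move=> *; rewrite mule_ge0// t0..].
apply: lee_nneseries => [*|j _]; first exact: t0.
rewrite coordD -!EFinM -EFinD lee_fin -subr_ge0.
set u := c x j; set v := c y j; set w := weight j.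
have -> : (1 + e) * (w * u ^+ 2) + (1 + e^-1) * (w * v ^+ 2)
          - w * (u + v) ^+ 2 = w * (e^-1 * (e * u - v) ^+ 2).
  by field; rewrite gt_eqF.
by rewrite mulr_ge0 ?powR_ge0// mulr_ge0 ?sqr_ge0// invr_ge0 ltW.
Qed.

Lemma finite_sqnorm_submod : submod_closed finite_sqnorm.
Proof.
split; first by rewrite /in_mem/= /finite_sqnorm sqnorm0 ltry.
move=> a x y; rewrite /in_mem/= /finite_sqnorm => xoo yoo.
apply: le_lt_trans (sqnorm_young _ _ ltr01) _.
rewrite sqnormZ -(@fineK _ (sqnorm x)) ?ge0_fin_numE ?sqnorm_ge0//.
by rewrite -(@fineK _ (sqnorm y)) ?ge0_fin_numE ?sqnorm_ge0// -!EFinM -EFinD ltry.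
Qed.

HB.instance Definition _ :=
  GRing.isSubmodClosed.Build R V finite_sqnorm finite_sqnorm_submod.
HB.instance Definition _ := [SubChoice_isSubLmodule of sobolev by <:].

Lemma sobolev_valD (x y : sobolev) :
  sobolev_val (x + y) = sobolev_val x + sobolev_val y.
Proof. by []. Qed.

Lemma sobolev_valZ a (x : sobolev) : sobolev_val (a *: x) = a *: sobolev_val x.
Proof. by []. Qed.

Definition sobolev_norm (x : sobolev) : R :=
  Num.sqrt (fine (sqnorm (sobolev_val x))).

Let fin x : (sqnorm (sobolev_val x) \is a fin_num)%E.
Proof. by rewrite ge0_fin_numE ?sqnorm_ge0//; case: x. Qed.

Let sqr_norm x : (sqnorm (sobolev_val x) = (sobolev_norm x ^+ 2)%:E)%E.
Proof. by rewrite sqr_sqrtr ?fineK// fine_ge0// sqnorm_ge0. Qed.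

Lemma sobolev_normZ a x : sobolev_norm (a *: x) = `|a| * sobolev_norm x.
Proof.
rewrite /sobolev_norm sobolev_valZ sqnormZ fineM// sqrtrM ?sqr_ge0//.
by rewrite sqrtr_sqr.
Qed.

Lemma sobolev_norm_eq0 x : sobolev_norm x = 0 -> x = 0.
Proof.
move=> x0; apply: val_inj => /=; change (sobolev_val x = 0).
apply: (@coord_eq0 _ _ c) => j.
have : (sqnorm (sobolev_val x) <= 0)%E by rewrite sqr_norm x0 expr0n.
apply: contraTeq => xj0; rewrite -ltNge.
have ge := @nneseries_lim_ge R _ xpredT 0%N j.+1 (fun k _ _ => t0 (sobolev_val x) k).
apply: lt_le_trans ge; rewrite big_nat_recr//= -[ltLHS]adde0 lee_ltD//.
  by apply: sume_ge0 => k _; exact: t0.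
by rewrite lte_fin mulr_gt0 ?powR_gt0// exprn_even_gt0.
Qed.

Lemma ler_sobolev_normD x y :
  sobolev_norm (x + y) <= sobolev_norm x + sobolev_norm y.
Proof.
have n0 z : 0 <= sobolev_norm z by exact: sqrtr_ge0.
have [/sobolev_norm_eq0 ->|x0] := eqVneq (sobolev_norm x) 0.
  by rewrite add0r lerDr.
have [/sobolev_norm_eq0 ->|y0] := eqVneq (sobolev_norm y) 0.
  by rewrite addr0 lerDl.
have xp : 0 < sobolev_norm x by rewrite lt_def x0 n0.
have yp : 0 < sobolev_norm y by rewrite lt_def y0 n0.
rewrite -(@ler_pXn2r _ 2)// ?nnegrE ?addr_ge0// -lee_fin -sqr_norm.
rewrite sobolev_valD; apply: le_trans (sqnorm_young _ _ (divr_gt0 yp xp)) _.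
rewrite !sqr_norm -!EFinM -EFinD lee_fin le_eqVlt; apply/orP; left; apply/eqP.
by field; rewrite x0 y0.
Qed.

HB.instance Definition _ := Lmodule_isNormed.Build R sobolev
  ler_sobolev_normD sobolev_normZ sobolev_norm_eq0.

End SobolevScale.

Record orthobasis (R : realType) (H : completeNormedModType R)
    (ip : {dot H for (@idfun R)}) := Orthobasis {
  basis :> nat -> H ;
  basis_orthonormal : forall i j, ip (basis i) (basis j) = (i == j)%:R ;
  basis_complete : forall x, (forall j, ip x (basis j) = 0) -> x = 0 }.

Section HilbertSpaces.
Context {R : realType}.

Definition seq_coordinates : coordinates (nat -> R^o).
Proof.
by refine (@Coordinates R (nat -> R^o) (fun x j => x j) _ _) => // x x0;
  apply/funext.
Defined.

Context {H : completeNormedModType R} {ip : {dot H for (@idfun R)}}.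
Variable phi : orthobasis ip.

Definition basis_coordinates : coordinates H.
Proof.
refine (@Coordinates R H (fun x j => ip x (phi j)) _ (@basis_complete _ _ _ phi)).
by move=> a x y j; rewrite linearPl.
Defined.

Lemma finite_sqnorm_basis r j : finite_sqnorm basis_coordinates r (phi j).
Proof.
rewrite /finite_sqnorm /sqnorm (nneseries_split _ j.+1); last first.
  by move=> *; rewrite lee_fin mulr_ge0 ?powR_ge0 ?sqr_ge0.
rewrite [X in (_ + X)%E]eseries0 ?adde0; last first.
  move=> k jk _ /=; rewrite basis_orthonormal.
  by rewrite ltn_eqF ?expr0n ?mulr0// (leq_trans _ jk).
by rewrite sumEFin ltry.
Qed.

Definition sob_basis r j : sobolev basis_coordinates r :=
  Sobolev (finite_sqnorm_basis r j).

End HilbertSpaces.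

(* For s >= 0, H^s is a subspace of H. The space H^(-s) is in general not
   contained in H (it is the completion of H for |.|_(-s)); its element
   \sum_j y_j phi_j is represented by the sequence y of its coefficients. *)
Notation Hsp phi s := (sobolev (basis_coordinates phi) s).

Notation Hdual R s := (sobolev (@seq_coordinates R) (- s)).

Section Operators.
Context {R : realType} {H : completeNormedModType R} {ip : {dot H for (@idfun R)}}.
Variable phi : orthobasis ip.

(* For a positive operator, being trace class amounts to the finiteness of the
   trace computed in an orthonormal basis. *)
Definition positive_trace_class (C : {linear H -> H}) : Prop :=
  [/\ continuous C,
      (forall x y, ip (C x) y = ip x (C y)),
      (forall x, 0 <= ip (C x) x) &
      (\sum_(0 <= j <oo) (ip (C (phi j)) (phi j))%:E < +oo)%E].

Context {s : R}.

(* The extension of <., .> to H^(-s) x H^s, by which H^(-s) is the dual of H^s. *)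
Definition dual_pairing (y : Hdual R s) (x : Hsp phi s) : R :=
  limn (series (fun j => sobolev_val y j * ip (sobolev_val x) (phi j))).

(* The extension to H^(-s) of the operator C such that C phi_j = lam_j^2 phi_j;
   the sum is taken in H^s. *)
Definition cov_dual (lam : nat -> R) (y : Hdual R s) : Hsp phi s :=
  limn (series (fun j => (lam j ^+ 2 * sobolev_val y j) *: sob_basis phi s j)).

(* G is defined on H^s only; H^s is stable by an operator C that is diagonal in
   the basis phi, and Cx denotes C x as an element of H^s. *)
Definition commutes_with (C : {linear H -> H})
    (G : {linear Hsp phi s -> Hsp phi s}) : Prop :=
  forall x Cx : Hsp phi s, sobolev_val Cx = C (sobolev_val x) ->
    sobolev_val (G Cx) = C (sobolev_val (G x)).

(* S is the nonnegative symmetric square root of A, for the inner product of H. *)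
Definition is_sqrt (S A : Hsp phi s -> Hsp phi s) : Prop :=
  [/\ forall x y, ip (sobolev_val (S x)) (sobolev_val y)
                  = ip (sobolev_val x) (sobolev_val (S y)),
      forall x, 0 <= ip (sobolev_val (S x)) (sobolev_val x) &
      forall x, S (S x) = A x].

Definition drift (lam : nat -> R) (DPsi : Hsp phi s -> Hdual R s)
    (G1 G2 : Hsp phi s -> Hsp phi s) (x : Hsp phi s * Hsp phi s) :
    Hsp phi s * Hsp phi s :=
  let F := x.1 + cov_dual lam (DPsi x.1) in
  (x.2 - G1 F, - F - G2 x.2).

End Operators.

Section Paths.
Context {R : realType}.

(* I = \int_a^b f(u) du in X: the integral is characterized by its values on
   the continuous linear functionals (Pettis). *)
Definition weak_integral (X : normedModType R) (f : R -> X) (a b : R) (I : X) :=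
  forall l : {linear X -> R^o}, continuous l ->
    (@lebesgue_measure R).-integrable `[a, b] (fun u => (l (f u))%:E) /\
    (l I)%:E = (\int[@lebesgue_measure R]_(u in `[a, b]) (l (f u))%:E)%E.

Definition continuous_path (X : normedModType R) (T : R) (x : R -> X) : Prop :=
  {within `[0, T], continuous x}.

(* x(t) = x0 + \int_0^t G(x(u)) du + S(W(t)) on [0, T]. Here x0 is the prescribed
   initial condition; it is x(0) when W(0) = 0. Keeping x0 in the equation
   makes it meaningful for every driving path W, even when W(0) is not 0. *)
Definition is_solution (X : normedModType R) (G S : X -> X) (x0 : X)
    (W : R -> X) (T : R) (x : R -> X) : Prop :=
  continuous_path T x /\
  forall t, t \in `[0, T] ->
    exists2 I, weak_integral (G \o x) 0 t I & x t = x0 + I + S (W t).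

(* The library norm of X * X is the maximum norm, with the same topology. *)
Definition prod_norm (X : normedModType R) (w : X * X) : R :=
  Num.sqrt (`|w.1| ^+ 2 + `|w.2| ^+ 2).

Definition sup_dist (X : normedModType R) (T : R) (x y : R -> X * X) : R :=
  sup [set prod_norm (x t - y t) | t in `[0, T]].

End Paths.

Section Brownian.
Context {d : measure_display} {Omega : measurableType d} {R : realType}.
Variable P : probability Omega R.

(* Mutual independence of a family of set systems. *)
Definition independent (I : eqType) (F : I -> set (set Omega)) : Prop :=
  forall (J : seq I) (E : I -> set Omega), uniq J ->
    (forall i, i \in J -> F i (E i)) ->
    P (\bigcap_(i in [set` J]) E i) = (\prod_(i <- J) P (E i))%E.

(* The sigma-algebra generated by the random variables Y t, t >= 0. *)
Definition sigma_process (X : topologicalType) (Y : R -> Omega -> X) :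
    set (set Omega) :=
  <<s [set E | exists2 t, 0 <= t & exists2 U, open U & E = Y t @^-1` U] >>.

Definition is_process (X : topologicalType) (Y : R -> Omega -> X) : Prop :=
  forall t U, 0 <= t -> open U -> measurable (Y t @^-1` U).

Record standard_brownian (b : R -> Omega -> R) : Prop := {
  bm_process : is_process b ;
  bm_start : {ae P, forall w, b 0 w = 0} ;
  bm_continuous : {ae P, forall w, {within `[0, +oo[, continuous (b ^~ w)}} ;
  bm_increment : forall s t, 0 <= s -> s < t ->
    forall A : set R, measurable A ->
      P ((fun w => b t w - b s w) @^-1` A) = normal_prob 0 (Num.sqrt (t - s)) A ;
  bm_independent : forall t : nat -> R, 0 <= t 0%N -> (forall k, t k <= t k.+1) ->
    independent (fun k => preimage_set_system setT
      (fun w => b (t k.+1) w - b (t k) w) measurable) }.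

Context {H : completeNormedModType R} {ip : {dot H for (@idfun R)}}.
Variables (phi : orthobasis ip) (s : R) (lam : nat -> R).

(* B(t) = \sum_j lam_j b_j(t) phi_j in H^s, almost surely for all t, with b_j
   independent standard Brownian motions. The continuity of the paths of B in
   H^s is not part of the definition. *)
Definition Cs_brownian (B : R -> Omega -> Hsp phi s) : Prop :=
  is_process B /\
  exists b : nat -> R -> Omega -> R,
    [/\ forall j, standard_brownian (b j),
        independent (fun j => sigma_process (b j)) &
        {ae P, forall w, forall t, 0 <= t ->
          series (fun j => (lam j * b j t w) *: sob_basis phi s j) @ \oo
            --> B t w}].

Definition Cs_brownian_pair (B : R -> Omega -> Hsp phi s * Hsp phi s) : Prop :=
  let B1 t w := (B t w).1 in let B2 t w := (B t w).2 in
  [/\ Cs_brownian B1, Cs_brownian B2 &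
      independent (fun i : bool => sigma_process (if i then B1 else B2))].

End Brownian.

(* Main.v *)
(* The drift is globally Lipschitz on H^s x H^s: the bound on the second derivative
   makes DPsi Lipschitz from H^s to H^(-s), and C maps H^(-s) boundedly to H^s since
   lam_j^2 j^(2s) is bounded. Picard iteration in the norm
   sup_t exp(- 2 L t) |x(t)| therefore solves the integral equation for every
   continuous driving path, and the same weighted norm shows that the solution
   depends on that path in a Lipschitz way.

   It remains to see that almost every path of the Brownian motion is continuous in
   H^s. Chaining over dyadic times bounds sup_t b_j(t)^2 by 100 (1 + Y_j), where Y_j
   is a weighted sum of fourth powers of dyadic increments whose mean is bounded
   independently of j. As \sum_j j^(2s) lam_j^2 is finite, so is almost surely
   \sum_j j^(2s) lam_j^2 sup_t b_j(t)^2, and the series converges uniformly. *)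

Require Import Defs.
From HB Require Import structures.
From mathcomp Require Import all_boot all_order all_algebra.
From mathcomp Require Import all_classical all_reals all_analysis.
From mathcomp Require Import measurable_realfun zify ring lra.

Set Implicit Arguments.
Unset Strict Implicit.
Unset Printing Implicit Defensive.

Import Order.TTheory GRing.Theory Num.Theory.
Import numFieldNormedType.Exports.

Local Open Scope classical_set_scope.
Local Open Scope ring_scope.

(** * Sobolev norms *)

(** The integral in the equation is given only by its values on continuous linear forms, which
    shapes the proof. A norm estimate on an integral is obtained by testing it on forms of norm at
    most 1, which reduces it to a real integral; the mean value inequality for [DPsi] is reduced in
    the same way to the real one along a segment. Existence of the integral has to be proved: its
    coordinates must be the integrals of the coordinates, and a duality estimate shows that they
    define an element of H^s.

    The rate [2 L] of the weight makes one integration a contraction of factor 1/2.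

    Fourth powers of increments are used because the squares of the 2^n increments of level n have a
    mean sum that does not decay with n. For fourth powers it is of order 2^(-n), which leaves room
    for a weight (10/9)^(4n), since (10/9)^4 / 2 < 4/5. The increments of level n are then at most
    (9/10)^n times a random constant; the sum of (9/10)^n is 10, whence the constant 100 = 10^2. *)

Section SobolevNorm.
Context {R : realType} {V : lmodType R} {c : coordinates V} {r : R}.
Local Notation E := (sobolev c r).

(** Real partial sums of the series [sqnorm]: norm bounds are proved on them, away from the extended
    reals. *)
Definition partial_sqnorm (x : V) (N : nat) : R :=
  \sum_(0 <= j < N) weight r j * c x j ^+ 2.

Lemma weight_gt0 j : 0 < weight r j :> R.
Proof. by rewrite powR_gt0. Qed.

Lemma weight_sqr_ge0 (a : R) j : 0 <= weight r j * a ^+ 2.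
Proof. by rewrite mulr_ge0 ?sqr_ge0// ltW// weight_gt0. Qed.

Lemma partial_sqnorm_le_sqnorm x N :
  ((partial_sqnorm x N)%:E <= sqnorm c r x)%E.
Proof.
rewrite /partial_sqnorm -sumEFin; apply: nneseries_lim_ge => j _ _.
by rewrite lee_fin weight_sqr_ge0.
Qed.

Lemma sqnorm_le x (K : R) :
  (forall N, partial_sqnorm x N <= K) -> (sqnorm c r x <= K%:E)%E.
Proof.
move=> xK; apply: lime_le.
  by apply: is_cvg_nneseries => j _ _; rewrite lee_fin weight_sqr_ge0.
by apply: nearW => N; rewrite sumEFin lee_fin xK.
Qed.

Lemma sqnormE (x : E) : sqnorm c r (sobolev_val x) = (`|x| ^+ 2)%:E.
Proof.
rewrite /Num.norm/= /sobolev_norm sqr_sqrtr ?fine_ge0 ?sqnorm_ge0// fineK//.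
by rewrite ge0_fin_numE ?sqnorm_ge0//; case: x.
Qed.

Lemma partial_sqnorm_le (x : E) N : partial_sqnorm (sobolev_val x) N <= `|x| ^+ 2.
Proof. by rewrite -lee_fin -sqnormE partial_sqnorm_le_sqnorm. Qed.

Lemma sobolev_norm_le (x : E) (K : R) : 0 <= K ->
  (forall N, partial_sqnorm (sobolev_val x) N <= K ^+ 2) -> `|x| <= K.
Proof.
by move=> K0 /sqnorm_le; rewrite sqnormE lee_fin ler_pXn2r// nnegrE.
Qed.

Lemma cvg_partial_sqnorm (x : E) :
  partial_sqnorm (sobolev_val x) N @[N --> \oo] --> `|x| ^+ 2.
Proof.
suff : EFin \o partial_sqnorm (sobolev_val x) @ \oo --> (`|x| ^+ 2)%:E.
  by move/fine_cvgP => [].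
rewrite -sqnormE.
have -> : (EFin \o partial_sqnorm (sobolev_val x)) =
    (fun N => \sum_(0 <= j < N) (weight r j * c (sobolev_val x) j ^+ 2)%:E)%E.
  by apply/funext => N; rewrite sumEFin.
by apply: is_cvg_nneseries => j _ _; rewrite lee_fin weight_sqr_ge0.
Qed.

Lemma finite_sqnorm_bounded x (K : R) :
  (forall N, partial_sqnorm x N <= K) -> finite_sqnorm c r x.
Proof. by move=> /sqnorm_le/le_lt_trans; apply; rewrite ltry. Qed.

(** Used for truncations, which do not increase the norm, and to dominate the remainder of one
    expansion by that of another. *)
Lemma sobolev_norm_mono (x y : E) :
  (forall j, `|c (sobolev_val x) j| <= `|c (sobolev_val y) j|) -> `|x| <= `|y|.
Proof.
move=> xy; apply: sobolev_norm_le => // N.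
apply: le_trans (partial_sqnorm_le y N); apply: ler_sum => j _.
rewrite ler_pM2l ?weight_gt0// -[leLHS]real_normK ?num_real//.
by rewrite -[leRHS]real_normK ?num_real// ler_pXn2r ?nnegrE.
Qed.

Lemma coord_sqr_le (x : E) j :
  weight r j * c (sobolev_val x) j ^+ 2 <= `|x| ^+ 2.
Proof.
apply: le_trans (partial_sqnorm_le x j.+1).
rewrite /partial_sqnorm big_nat_recr//= lerDr.
by apply: sumr_ge0 => i _; exact: weight_sqr_ge0.
Qed.

Lemma coord_norm_le (x : E) j :
  `|c (sobolev_val x) j| <= Num.sqrt (weight r j)^-1 * `|x|.
Proof.
rewrite -(@ler_pXn2r _ 2)// ?nnegrE ?mulr_ge0//.
rewrite exprMn sqr_sqrtr ?invr_ge0; last by rewrite ltW// weight_gt0.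
by rewrite real_normK ?num_real// ler_pdivlMl ?weight_gt0// coord_sqr_le.
Qed.

Definition coord_fun j (x : E) : R^o := c (sobolev_val x) j.

Lemma coord_fun_is_linear j : linear (coord_fun j).
Proof. by move=> a x y; rewrite /coord_fun coord_linear. Qed.

HB.instance Definition _ j :=
  GRing.isLinear.Build R E R^o _ (coord_fun j) (coord_fun_is_linear j).

Definition coord_form (a : nat -> R) N (x : E) : R^o :=
  \sum_(0 <= j < N) a j * c (sobolev_val x) j.

Lemma coord_form_is_linear a N : linear (coord_form a N).
Proof.
move=> k x y; rewrite /coord_form scaler_sumr -big_split/=.
by apply: eq_bigr => j _; rewrite coord_linear mulrDr mulrCA.
Qed.

HB.instance Definition _ a N :=
  GRing.isLinear.Build R E R^o _ (coord_form a N) (coord_form_is_linear a N).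

End SobolevNorm.
Arguments coord_fun {R V c r} j x : simpl never.

Section LinearForms.
Context {R : realType}.

Lemma bounded_linear_cts (V W : normedModType R) (f : {linear V -> W}) (K : R) :
  (forall x, `|f x| <= K * `|x|) -> continuous f.
Proof.
move=> fK; apply: bounded_linear_continuous; apply/linear_boundedP.
near=> k => x; apply: le_trans (fK x) _; by rewrite ler_wpM2r.
Unshelve. all: by end_near. Qed.

Lemma cts_linear_bounded (V W : normedModType R) (f : {linear V -> W}) :
  continuous f -> exists2 K, 0 <= K & forall x, `|f x| <= K * `|x|.
Proof.
move=> /linear_bounded_continuous/linear_boundedP/pinfty_ex_gt0[K K0 fK].
by exists K => //; exact: ltW.
Qed.

(* True of every normed space by the Hahn-Banach theorem, which the library lacks;
   in H^s, finite sums of coordinates provide the norming forms. *)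
Definition normed_by_forms (X : normedModType R) := forall (z : X) (K : R), 0 <= K ->
  (forall l : {linear X -> R^o}, continuous l -> (forall y, `|l y| <= `|y|) ->
     `|l z| <= K) -> `|z| <= K.

(** The polynomial [A + 2 * t * S + t ^+ 2 * B] in [t] is a weighted sum of squares, hence
    nonnegative. *)
Lemma Cauchy_Schwarz_sum (I : Type) (s : seq I) (w a b : I -> R) :
  (forall i, 0 <= w i) ->
  `|\sum_(i <- s) w i * a i * b i| <=
    Num.sqrt (\sum_(i <- s) w i * a i ^+ 2) * Num.sqrt (\sum_(i <- s) w i * b i ^+ 2).
Proof.
move=> w0; set S := \sum_(i <- s) _; set A := \sum_(i <- s) _.
set B := \sum_(i <- s) _.
have q0 (f : I -> R) : 0 <= \sum_(i <- s) w i * f i ^+ 2.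
  by apply: sumr_ge0 => i _; rewrite mulr_ge0 ?sqr_ge0.
have quad t : 0 <= A + 2 * t * S + t ^+ 2 * B.
  have := q0 (fun i => a i + t * b i); congr (_ <= _).
  rewrite /A /S /B !mulr_sumr -!big_split/=.
  by apply: eq_bigr => i _; ring.
rewrite -sqrtrM ?q0// -sqrtr_sqr ler_wsqrtr//.
have [B0|B0] := eqVneq B 0.
  have [->|S0] := eqVneq S 0; first by rewrite expr0n/= mulr_ge0 ?q0.
  (* For [B = 0] the polynomial is affine of slope [2 * S]; at this point it would be -1. *)
  have := quad (- (A + 1) / (2 * S)); rewrite B0 mulr0 addr0.
  rewrite (_ : _ + _ = -1); last by field.
  by rewrite ler0N1.
have Bp : 0 < B by rewrite lt_def B0 q0.
(* The point where the polynomial is minimal. *)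
have := quad (- S / B).
rewrite (_ : _ + _ = (A * B - S ^+ 2) / B); last by field.
by rewrite pmulr_lge0 ?invr_gt0// subr_ge0.
Qed.

Context {V : lmodType R} {c : coordinates V} {r : R}.
Local Notation E := (sobolev c r).

Lemma coord_fun_continuous j : continuous (coord_fun j : E -> R^o).
Proof. by apply: bounded_linear_cts => x; exact: coord_norm_le. Qed.

(** The norming form for the first [N] coordinates is the product of H^s with the truncation of [z],
    divided by the norm [Num.sqrt q] of that truncation. It has norm at most 1 by Cauchy-Schwarz and
    takes the value [Num.sqrt q] at [z]. *)
Lemma sobolev_normed_by_forms : normed_by_forms E.
Proof.
move=> z K K0 zK; apply: sobolev_norm_le => // N.
set q := partial_sqnorm _ N.
have q0 : 0 <= q by apply: sumr_ge0 => j _; exact: weight_sqr_ge0.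
have [->|qn0] := eqVneq q 0; first by rewrite sqr_ge0.
have sq0 : 0 < Num.sqrt q by rewrite sqrtr_gt0 lt_def qn0.
pose l : {linear E -> R^o} := coord_form
  (fun j => (Num.sqrt q)^-1 * (weight r j * c (sobolev_val z) j)) N.
have lE y : l y = (Num.sqrt q)^-1 * \sum_(0 <= j < N)
    weight r j * c (sobolev_val z) j * c (sobolev_val y) j.
  by rewrite /l/= /coord_form mulr_sumr; apply: eq_bigr => j _; rewrite -!mulrA.
have l1 y : `|l y| <= `|y|.
  rewrite lE normrM gtr0_norm ?invr_gt0// ler_pdivrMl//.
  apply: le_trans (Cauchy_Schwarz_sum _ _ _ _) _.
    by move=> j; rewrite ltW// weight_gt0.
  rewrite ler_wpM2l// -[leRHS]ger0_norm// -sqrtr_sqr ler_wsqrtr//.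
  exact: partial_sqnorm_le.
have := zK l _ l1; rewrite lE.
have -> : \sum_(0 <= j < N) weight r j * c (sobolev_val z) j *
    c (sobolev_val z) j = q.
  by apply: eq_bigr => j _; rewrite -mulrA -expr2.
rewrite -{2}(sqr_sqrtr q0) expr2 mulKf ?gt_eqF// ger0_norm// => qK.
rewrite -(sqr_sqrtr q0) ler_pXn2r ?nnegrE//; apply: qK.
by apply: (@bounded_linear_cts _ _ _ 1) => y; rewrite mul1r.
Qed.

End LinearForms.

Section Completeness.
Context {R : realType}.

Lemma cvg_sum (X : normedModType R) (I T : Type) (F : set_system T) (FF : Filter F)
    (s : seq I) (f : I -> T -> X) (a : I -> X) :
  (forall i, f i t @[t --> F] --> a i) ->
  (\sum_(i <- s) f i t) @[t --> F] --> \sum_(i <- s) a i.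
Proof.
move=> fa; elim: s => [|i s ih].
  by rewrite big_nil; under eq_cvg do rewrite big_nil; exact: cvg_cst.
by rewrite big_cons; under eq_cvg do rewrite big_cons; exact: cvgD.
Qed.

(** Comparing every later term with the single term [u N] gives the usual Cauchy condition, up to a
    factor 2 in [e]. *)
Definition cauchy_sequence (X : normedModType R) (u : nat -> X) : Prop :=
  forall e, 0 < e -> exists N, forall n, (N <= n)%N -> `|u N - u n| <= e.

(* [sobolev] carries no canonical complete structure, whence this predicate. *)
Definition sequentially_complete (X : normedModType R) : Prop :=
  forall u : nat -> X, cauchy_sequence u -> exists x : X, u @ \oo --> x.

Lemma complete_sequentially_complete (X : completeNormedModType R) :
  sequentially_complete X.
Proof.
move=> u cu; apply/cvg_ex; apply: cauchy_cvg; apply: cauchy_exP => e e0.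
have [N uN] := cu (e / 2) (divr_gt0 e0 (ltr0Sn _ 1)).
exists (u N); exists N => // n /= Nn.
rewrite -ball_normE/=; apply: le_lt_trans (uN n Nn) _.
by rewrite gtr_pMr// invf_lt1 ?ltr1n.
Qed.

Lemma prod_sequentially_complete (X Y : normedModType R) :
  sequentially_complete X -> sequentially_complete Y ->
  sequentially_complete (X * Y)%type.
Proof.
move=> cX cY u cu.
have [x ux] : exists x : X, (fun n => (u n).1) @ \oo --> x.
  apply: cX => e /cu[N uN]; exists N => n /uN; apply: le_trans.
  by rewrite prod_normE/= le_max lexx.
have [y uy] : exists y : Y, (fun n => (u n).2) @ \oo --> y.
  apply: cY => e /cu[N uN]; exists N => n /uN; apply: le_trans.
  by rewrite prod_normE/= le_max lexx orbT.
exists (x, y).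
have -> : u = (fun n => ((u n).1, (u n).2)) by apply/funext => n; case: (u n).
exact: cvg_pair.
Qed.

End Completeness.

(** * Expansions in the orthonormal basis *)

Section HilbertExpansion.
Context {R : realType} {H : completeNormedModType R}
  {ip : {dot H for (@idfun R)}}.
Hypothesis ip_norm : forall x : H, ip x x = `|x| ^+ 2.
Variable phi : orthobasis ip.

Lemma ip_sym x y : ip x y = ip y x.
Proof. by rewrite (hermC ip x y)/= expr0 mul1r. Qed.

(** Bessel's inequality for one vector: the square of the norm of [x - a *: phi j] is
    [|x|^2 - a^2]. *)
Lemma ip_basis_le x j : `|ip x (phi j)| <= `|x|.
Proof.
set a := ip x _.
have : 0 <= ip (- a *: phi j + x) (- a *: phi j + x).
  by rewrite ip_norm sqr_ge0.
rewrite linearPl/= !linearPr/= basis_orthonormal eqxx mulr1.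
rewrite (ip_sym (phi j)) -/a ip_norm.
rewrite (_ : _ + _ = `|x| ^+ 2 - `|a| ^+ 2); last first.
  by rewrite real_normK ?num_real//= /GRing.scale/=; ring.
by rewrite subr_ge0 ler_pXn2r ?nnegrE.
Qed.

Lemma ip_sum_basis (y : nat -> R) m n k :
  ip (\sum_(m <= j < n) y j *: phi j) (phi k) =
  if (m <= k < n)%N then y k else 0.
Proof.
rewrite linear_sumlz/=.
under eq_bigr do rewrite linearZl_LR/= basis_orthonormal.
case: ifPn => [kn|kn].
  rewrite (bigD1_seq k) ?mem_index_iota ?iota_uniq//= eqxx.
  rewrite big1 ?addr0; first by rewrite /GRing.scale/= mulr1.
  by move=> j /negPf jk; rewrite jk /GRing.scale/= mulr0.
rewrite big_nat big1// => j jn; case: eqVneq => [jk|_]; last first.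
  by rewrite /GRing.scale/= mulr0.
by move: kn; rewrite -jk jn.
Qed.

Lemma norm_sum_basis (y : nat -> R) m n :
  `|\sum_(m <= j < n) y j *: phi j| ^+ 2 = \sum_(m <= j < n) y j ^+ 2.
Proof.
rewrite -ip_norm linear_sumr/=; apply: eq_big_nat => j jn.
by rewrite linearZr_LR/= ip_sum_basis jn /GRing.scale/= expr2.
Qed.

(** The Riesz-Fischer theorem: by orthonormality the blocks of the series have as squared norm the
    blocks of a bounded nondecreasing sum, so the partial sums are Cauchy in [H]. *)
Lemma exists_coordinates (y : nat -> R) (K : R) :
  (forall N, \sum_(0 <= j < N) y j ^+ 2 <= K) ->
  exists x : H, forall j, ip x (phi j) = y j.
Proof.
move=> yK; pose u N := \sum_(0 <= j < N) y j *: phi j.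
pose q N := \sum_(0 <= j < N) y j ^+ 2.
have q_nd : nondecreasing_seq q.
  apply/nondecreasing_seqP => n; rewrite /q big_nat_recr//= lerDl.
  exact: sqr_ge0.
have q_cvg : cvgn q.
  by apply: nondecreasing_is_cvgn => //; exists K => _ [n _ <-]; exact: yK.
have q_le n : q n <= limn q by exact: nondecreasing_cvgn_le.
have [x ux] : exists x : H, u @ \oo --> x.
  apply: complete_sequentially_complete => e e0.
  have /cvgrPdist_le/(_ _ (exprn_gt0 2 e0))[N _ qN] := q_cvg.
  exists N => n Nn; rewrite -(@ler_pXn2r _ 2) ?nnegrE ?(ltW e0)//.
  have -> : u N - u n = - \sum_(N <= j < n) y j *: phi j.
    by rewrite /u (big_cat_nat (leq0n N) Nn)//= opprD addrA subrr add0r.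
  rewrite normrN norm_sum_basis.
  have -> : \sum_(N <= j < n) y j ^+ 2 = q n - q N.
    by rewrite /q (big_cat_nat (leq0n N) Nn)//= addrAC subrr add0r.
  have := qN N (leqnn N); rewrite ger0_norm ?subr_ge0 ?q_le//.
  by move=> h; apply: le_trans h; rewrite lerD2r q_le.
exists x => j; apply/eqP; rewrite -subr_eq0 -normr_eq0 eq_le normr_ge0 andbT.
apply/ler_addgt0Pl => e e0; rewrite addr0.
have /cvgrPdist_le/(_ _ e0)[N _ uN] := ux.
have := uN (maxn N j.+1) (leq_maxl _ _); apply: le_trans.
apply: le_trans (ip_basis_le _ j).
have uj : ip (u (maxn N j.+1)) (phi j) = y j.
  by have := ip_sum_basis y 0 (maxn N j.+1) j; rewrite leq0n/= leq_maxr.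
by rewrite linearBl/= uj.
Qed.

End HilbertExpansion.

Section SobolevHilbert.
Context {R : realType} {H : completeNormedModType R}
  {ip : {dot H for (@idfun R)}}.
Hypothesis ip_norm : forall x : H, ip x x = `|x| ^+ 2.
Variables (phi : orthobasis ip) (s : R).
Local Notation E := (Hsp phi s).

Lemma coord_funE j (x : E) : coord_fun j x = ip (sobolev_val x) (phi j).
Proof. by []. Qed.

Lemma coord_sob_series (a : nat -> R) N j :
  coord_fun j (series (fun i => a i *: sob_basis phi s i) N) =
  if (j < N)%N then a j else 0.
Proof.
rewrite /series/= linear_sum/=.
under eq_bigr do rewrite linearZ_LR/= coord_funE/= basis_orthonormal.
case: ifPn => jN.
  rewrite (bigD1_seq j) ?mem_index_iota ?iota_uniq//= eqxx.
  rewrite big1 ?addr0; first by rewrite /GRing.scale/= mulr1.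
  by move=> i /negPf ij; rewrite ij /GRing.scale/= mulr0.
rewrite big_nat big1// => i /= iN; case: eqVneq => [ij|_]; last first.
  by rewrite /GRing.scale/= mulr0.
by move: jN; rewrite -ij iN.
Qed.

(** The remainder has the coordinates of [x] from [N] on and 0 before, so its squared norm is at
    most [|x|^2] minus the partial sum, which tends to 0. *)
Lemma cvg_sob_series (x : E) :
  series (fun j => ip (sobolev_val x) (phi j) *: sob_basis phi s j) @ \oo --> x.
Proof.
set S := series _; set c := basis_coordinates phi.
pose psq := partial_sqnorm (c := c) (r := s) (sobolev_val x).
have psq_le N : psq N <= `|x| ^+ 2 by exact: (partial_sqnorm_le (c := c)).
have tail N : `|x - S N| <= Num.sqrt (`|x| ^+ 2 - psq N).
  apply: sobolev_norm_le => // M; rewrite sqr_sqrtr ?subr_ge0//.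
  have cj j : c (sobolev_val (x - S N)) j =
      if (j < N)%N then 0 else c (sobolev_val x) j.
    rewrite -[LHS]/(coord_fun j (x - S N)) linearB/= coord_sob_series.
    by rewrite coord_funE; case: ifP => _; rewrite ?subrr ?subr0.
  rewrite /partial_sqnorm; under eq_bigr do rewrite cj.
  have [MN|NM] := leqP M N.
    rewrite big_nat big1 ?subr_ge0// => j /= jM.
    by rewrite (leq_trans jM MN) expr0n mulr0.
  rewrite lerBrDl; apply: le_trans (psq_le M).
  rewrite /psq /partial_sqnorm !(big_cat_nat (leq0n N) (ltnW NM))/= lerD2l.
  rewrite [X in X + _]big_nat [X in X + _]big1 ?add0r; last first.
    by move=> j /= ->; rewrite expr0n mulr0.
  rewrite big_nat [leRHS]big_nat; apply: ler_sum => j /andP[Nj _].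
  by rewrite ltnNge Nj.
apply/cvgrPdist_le => e e0.
have /cvgrPdist_le/(_ _ (exprn_gt0 2 e0)) := @cvg_partial_sqnorm _ _ _ _ x.
apply: filterS => N; rewrite -/(psq N) ger0_norm ?subr_ge0// => h.
apply: le_trans (tail N) _; rewrite -(ger0_norm (ltW e0)) -sqrtr_sqr.
exact: ler_wsqrtr.
Qed.

(** The coordinate [j] is continuous and is constant along the partial sums from [j.+1] terms on. *)
Lemma coord_cvg_sob_series (a : nat -> R) (x : E) :
  series (fun j => a j *: sob_basis phi s j) @ \oo --> x ->
  forall j, ip (sobolev_val x) (phi j) = a j.
Proof.
move=> ax j; rewrite -coord_funE.
have h := @continuous_cvg nat _ _ _ _ _ (coord_fun j : E -> R^o) _
  (@coord_fun_continuous _ _ _ _ j x) ax.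
rewrite -(norm_cvg_lim (h _)); apply: norm_lim_near_cst.
by exists j.+1 => // N /= jN; rewrite coord_sob_series jN.
Qed.

Hypothesis s_ge0 : 0 <= s.

Lemma weight_ge1 j : 1 <= weight s j.
Proof.
rewrite /weight -[leLHS](powRr0 (j.+1%:R : R)) ler_powR ?ler1n//.
by rewrite mulr_ge0.
Qed.

(** For [s >= 0] the weights are at least 1, so [y] is square summable and already defines a vector
    of [H]; the same bound then puts this vector in H^s. *)
Lemma exists_sobolev (y : nat -> R) (K : R) :
  (forall N, \sum_(0 <= j < N) weight s j * y j ^+ 2 <= K) ->
  exists x : E, forall j, ip (sobolev_val x) (phi j) = y j.
Proof.
move=> yK; have [x xy] : exists x : H, forall j, ip x (phi j) = y j.
  apply: (@exists_coordinates _ _ _ ip_norm phi y K) => N.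
  apply: le_trans (yK N); apply: ler_sum => j _.
  by rewrite ler_peMl ?sqr_ge0// weight_ge1.
have xfin : finite_sqnorm (basis_coordinates phi) s x.
  apply: (finite_sqnorm_bounded (K := K)) => N; apply: le_trans (yK N).
  by apply: ler_sum => j _ /=; rewrite xy.
by exists (Sobolev xfin).
Qed.

Lemma sobolev_complete : sequentially_complete E.
Proof.
move=> u cu.
have cuj j : cauchy_sequence (fun n => coord_fun j (u n) : R^o).
  move=> e e0; set k := Num.sqrt (weight s j)^-1.
  have k0 : 0 < k by rewrite sqrtr_gt0 invr_gt0 weight_gt0.
  have [N uN] := cu (e / k) (divr_gt0 e0 k0).
  exists N => n /uN; rewrite -linearB/= ler_pdivlMr// mulrC.
  by apply: le_trans; exact: coord_norm_le.
have /choice[y uy] : forall j, exists y : R^o, coord_fun j (u n) @[n --> \oo] --> y.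
  by move=> j; apply: complete_sequentially_complete; exact: cuj.
have psq_cvg (z : E) N :
    \sum_(0 <= j < N) weight s j * (coord_fun j z - coord_fun j (u m)) ^+ 2
    @[m --> \oo] --> \sum_(0 <= j < N) weight s j * (coord_fun j z - y j) ^+ 2.
  apply: (@cvg_sum R R^o nat nat \oo _ (index_iota 0 N)
    (fun j m => weight s j * (coord_fun j z - coord_fun j (u m)) ^+ 2)) => j.
  have h : coord_fun j z - coord_fun j (u m) @[m --> \oo] --> coord_fun j z - y j.
    by apply: (@cvgB _ R^o) => //; exact: cvg_cst.
  exact: (cvgMl_tmp (cvgM h h)).
(* The Cauchy estimate of [u n - u m] is passed to the limit in [m] on each finite sum of
   coordinates. *)
have tail e : 0 < e -> exists N, forall n, (N <= n)%N -> forall M,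
    \sum_(0 <= j < M) weight s j * (coord_fun j (u n) - y j) ^+ 2 <= e ^+ 2.
  move=> e0; have [N uN] := cu (e / 2) (divr_gt0 e0 (ltr0Sn _ 1)).
  exists N => n Nn M; apply: (cvgr_to_le (psq_cvg (u n) M)).
  exists N => // m /= Nm.
  have unm : `|u n - u m| <= e.
    have h1 : `|u n - u N| <= e / 2 by rewrite distrC; exact: uN.
    have h2 := uN m Nm.
    apply: le_trans (ler_distD (u N) _ _) _.
    by rewrite [leRHS](splitr e); exact: lerD.
  apply: le_trans (_ : `|u n - u m| ^+ 2 <= _); last first.
    by rewrite ler_pXn2r ?nnegrE// ltW.
  apply: le_trans (partial_sqnorm_le (u n - u m) M).
  by apply: ler_sum => j _; rewrite -linearB.
have [N0 uN0] := tail 1 ltr01.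
(* The sequence [y] is not yet known to come from H^s, but its difference with the coordinates of
   [u N0] is, by [tail]; the limit is recovered as [u N0 - x]. *)
have [x xE] : exists x : E, forall j,
    ip (sobolev_val x) (phi j) = coord_fun j (u N0) - y j.
  exact: exists_sobolev (uN0 N0 (leqnn _)).
exists (u N0 - x); apply/cvgrPdist_le => e e0.
have [N uN] := tail e e0; exists N => // n /= Nn.
rewrite distrC; apply: sobolev_norm_le; first exact: ltW.
move=> M; apply: le_trans (uN n Nn M); apply: ler_sum => j _.
rewrite -[basis_coordinates phi _ j]/(coord_fun j (u n - (u N0 - x))).
by rewrite linearB/= (linearB _ (u N0))/= [coord_fun j x]coord_funE xE subKr.
Qed.

End SobolevHilbert.

(** * Continuous paths and their integrals *)

Section ContinuousPaths.
Context {R : realType}.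

Lemma continuous_pathP (X : normedModType R) (T : R) (x : R -> X) :
  continuous_path T x <-> forall t, t \in `[0, T] -> forall e, 0 < e ->
    exists2 d, 0 < d & forall t', t' \in `[0, T] -> `|t - t'| < d ->
      `|x t - x t'| <= e.
Proof.
rewrite /continuous_path; split.
  move/subspace_continuousP => cx t tT e e0.
  have := cx t tT => /cvgrPdist_le/(_ e e0).
  rewrite near_withinE => /nbhs_normP[d /= d0 dP].
  by exists d => // t' t'T tt'; exact: dP.
move=> cx; apply/subspace_continuousP => t tT.
apply/cvgrPdist_le => e e0; have [d d0 dP] := cx t tT e e0.
rewrite near_withinE; apply/nbhs_normP; exists d => //= t' tt' t'T.
exact: dP.
Qed.

Lemma lipschitz_path (X Y : normedModType R) (G : X -> Y) (L T : R) (x : R -> X) :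
  0 <= L -> (forall a b, `|G a - G b| <= L * `|a - b|) ->
  continuous_path T x -> continuous_path T (G \o x).
Proof.
move=> L0 GL /continuous_pathP cx; apply/continuous_pathP => t tT e e0.
have L1 : 0 < L + 1 by rewrite ltr_wpDl.
have [d d0 dP] := cx t tT _ (divr_gt0 e0 L1).
exists d => // t' t'T tt' /=; apply: le_trans (GL _ _) _.
apply: (@le_trans _ _ ((L + 1) * (e / (L + 1)))); last first.
  by rewrite mulrC divfK// gt_eqF.
by rewrite ler_pM// ?lerDl//; exact: dP.
Qed.

Lemma linear_path (X Y : normedModType R) (l : {linear X -> Y}) (T : R) (x : R -> X) :
  continuous l -> continuous_path T x -> continuous_path T (l \o x).
Proof.
move=> /cts_linear_bounded[K K0 lK]; apply: (lipschitz_path K0) => a b.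
by rewrite -linearB; exact: lK.
Qed.

Lemma continuous_pathW (X : normedModType R) (T t : R) (x : R -> X) : t <= T ->
  continuous_path T x -> continuous_path t x.
Proof.
move=> tT /continuous_pathP cx; apply/continuous_pathP => u ut e e0.
have sub v : v \in `[0, t] -> v \in `[0, T].
  by rewrite !in_itv/= => /andP[-> /le_trans]; exact.
have [d d0 dP] := cx u (sub _ ut) e e0.
by exists d => // v /sub; exact: dP.
Qed.

Lemma pathD (X : normedModType R) (T : R) (x y : R -> X) :
  continuous_path T x -> continuous_path T y ->
  continuous_path T (fun t => x t + y t).
Proof.
by move=> cx cy t; apply: cvgD; [exact: cx|exact: cy].
Qed.

Lemma path_cst (X : normedModType R) (T : R) (a : X) :
  continuous_path T (fun=> a).
Proof. by move=> t; exact: cvg_cst. Qed.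

Lemma path_bounded (X : normedModType R) (T : R) (x : R -> X) :
  continuous_path T x ->
  exists2 M, 0 <= M & forall t, t \in `[0, T] -> `|x t| <= M.
Proof.
move=> cx; have := continuous_compact cx (@segment_compact _ 0 T).
move=> /compact_bounded/ex_strict_bound_gt0[M M0 xM].
by exists M => [|t tT]; [exact: ltW|apply/ltW/xM; exists t].
Qed.

Lemma uniform_limit_path (X : normedModType R) (T : R) (x : R -> X) :
  (forall e, 0 < e -> exists2 y : R -> X, continuous_path T y &
     forall t, t \in `[0, T] -> `|x t - y t| <= e) ->
  continuous_path T x.
Proof.
move=> xy; apply/continuous_pathP => t tT e e0.
have e3 : 0 < e / 3 by rewrite divr_gt0.
have [y /continuous_pathP cy xye] := xy _ e3.
have [d d0 dP] := cy t tT _ e3; exists d => // t' t'T tt'.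
have h1 := xye t tT; have h2 := xye t' t'T; have h3 := dP t' t'T tt'.
have -> : x t - x t' = (x t - y t) + (y t - y t') + (y t' - x t').
  by rewrite !subrKA.
apply: le_trans (ler_normD _ _) _; rewrite (distrC (y t')).
have -> : e = e / 3 + e / 3 + e / 3 by field.
by rewrite lerD// (le_trans (ler_normD _ _))// lerD.
Qed.

Lemma path_integrable (t : R) (f : R -> R^o) : continuous_path t f ->
  (@lebesgue_measure R).-integrable `[0, t] (fun u => (f u)%:E).
Proof. exact/continuous_compact_integrable/segment_compact. Qed.

Lemma weak_integralE (X : normedModType R) (f : R -> X) (a b : R) (I : X)
    (l : {linear X -> R^o}) : continuous l -> weak_integral f a b I ->
  l I = \int[@lebesgue_measure R]_(u in `[a, b]) l (f u).
Proof. by move=> cl /(_ l cl)[_ lI]; rewrite /Rintegral -lI. Qed.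

Lemma continuous_expRM (lam : R) : continuous (fun u : R => expR (lam * u)).
Proof.
by move=> u; apply: continuous_comp; [exact: mulrl_continuous|exact: continuous_expR].
Qed.

Lemma integral_expR (lam t : R) : 0 < lam -> 0 <= t ->
  (\int[@lebesgue_measure R]_(u in `[0%R, t]) (expR (lam * u))%:E =
   ((expR (lam * t) - 1) / lam)%:E)%E.
Proof.
move=> lam0; rewrite le_eqVlt => /predU1P[<-|t0].
  by rewrite set_itv1 integral_set1 mulr0 expR0 subrr mul0r.
pose F (u : R) := expR (lam * u) / lam.
have dF (u : R) : is_derive u (1 : R) F (expR (lam * u)).
  apply: is_derive_eq; rewrite /GRing.scale/=.
  by field; rewrite gt_eqF.
have cF : continuous F by move=> u; apply/differentiable_continuous/derivable1_diffP.
rewrite (@continuous_FTC2 R _ F)//.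
- by rewrite -EFinD /F mulr0 expR0 mulrBl.
- exact/continuous_subspaceT/continuous_expRM.
- split => [u _|//|]; first exact: ex_derive.
  + exact/cvg_at_right_filter/cF.
  + exact/cvg_at_left_filter/cF.
- by move=> u _; rewrite derive1E derive_val.
Qed.

End ContinuousPaths.

Section WeakIntegral.
Context {R : realType} {X : normedModType R}.
Hypothesis X_normed : normed_by_forms X.
Local Notation mu := (@lebesgue_measure R).

(** Integrating the weight [expR (lam * u)] gains a factor [1 / lam], from which the contraction
    comes. Norming forms reduce the claim to real integrals. *)
Lemma weak_integral_expR_le (f g : R -> X) (t lam A : R) (I J : X) :
  0 < lam -> 0 <= A -> 0 <= t ->
  weak_integral f 0 t I -> weak_integral g 0 t J ->
  (forall u, u \in `[0, t] -> `|f u - g u| <= A * expR (lam * u)) ->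
  `|I - J| <= A / lam * (expR (lam * t) - 1).
Proof.
move=> lam0 A0 t0 fI gJ fg.
have e1 : 0 <= expR (lam * t) - 1.
  by rewrite subr_ge0 -[leLHS]expR0 ler_expR mulr_ge0// ltW.
apply: X_normed => [|l cl l1].
  by rewrite mulr_ge0// divr_ge0// ltW.
have [lf _] := fI l cl; have [lg _] := gJ l cl.
have iexp : mu.-integrable `[0, t] (EFin \o (fun u => expR (lam * u))).
  by apply: path_integrable; apply: continuous_subspaceT; exact: continuous_expRM.
have iE : mu.-integrable `[0, t] (EFin \o (fun u => A * expR (lam * u))).
  by apply: (integrableZl _ A iexp).
have ifg : mu.-integrable `[0, t] (EFin \o (fun u => l (f u) - l (g u))).
  by apply: (integrableB _ lf lg).
rewrite linearB/= (weak_integralE cl fI) (weak_integralE cl gJ) -RintegralB//.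
apply: le_trans (le_normr_Rintegral _ _) _ => //.
have -> : A / lam * (expR (lam * t) - 1) =
    \int[mu]_(u in `[0, t]) (A * expR (lam * u)).
  by rewrite RintegralZl// /Rintegral integral_expR//= mulrAC mulrA.
apply: le_Rintegral => //.
  exact: integrable_abse ifg.
move=> u tu; rewrite -linearB; apply: le_trans (l1 _) _; exact: fg.
Qed.

(** On each form, the two integrals differ by an integral over []t, t']], of measure [t' - t]. *)
Lemma weak_integral_lipschitz (f : R -> X) (t t' M : R) (I J : X) :
  0 <= M -> 0 <= t -> t <= t' ->
  weak_integral f 0 t I -> weak_integral f 0 t' J ->
  (forall u, u \in `[0, t'] -> `|f u| <= M) ->
  `|J - I| <= M * (t' - t).
Proof.
move=> M0 t0 tt' fI fJ fM.
apply: X_normed => [|l cl l1]; first by rewrite mulr_ge0// subr_ge0.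
have [lf _] := fJ l cl.
rewrite linearB/= (weak_integralE cl fI) (weak_integralE cl fJ).
rewrite Rintegral_itvB//.
have sub : `]t, t']%classic `<=` (`[0, t']%classic : set R).
  by move=> u/=; rewrite !in_itv/= => /andP[/ltW/(le_trans t0)-> ->].
have lf' : mu.-integrable `]t, t'] (EFin \o (fun u => l (f u))).
  by apply: (integrableS _ _ _ lf).
apply: le_trans (le_normr_Rintegral _ _) _ => //.
have muI : mu `]t, t'] = (t' - t)%:E.
  rewrite lebesgue_measure_itv/= lte_fin; case: ltP => [//|t't].
  by rewrite (_ : t' = t) ?subrr//; apply/eqP; rewrite eq_le tt' t't.
have iM : mu.-integrable `]t, t'] (EFin \o (fun=> M)).
  have iM' := path_integrable (@path_cst _ R^o t' M).
  by apply: (integrableS _ _ _ iM').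
have -> : M * (t' - t) = \int[mu]_(u in `]t, t']) M.
  by rewrite Rintegral_cst//; congr (_ * _); rewrite [X in fine X]muI.
apply: le_Rintegral => //.
- exact: integrable_abse lf'.
- by move=> u ut; apply: le_trans (l1 _) _; apply: fM; exact: sub.
Qed.

End WeakIntegral.

Section ProductSpace.
Context {R : realType} {X Y : normedModType R}.

Lemma norm_fst_le (z : X * Y) : `|z.1| <= `|z|.
Proof. by rewrite prod_normE/= le_max lexx. Qed.

Lemma norm_snd_le (z : X * Y) : `|z.2| <= `|z|.
Proof. by rewrite prod_normE/= le_max lexx orbT. Qed.

Lemma prod_norm_leP (z : X * Y) (K : R) :
  `|z.1| <= K -> `|z.2| <= K -> `|z| <= K.
Proof. by move=> h1 h2; rewrite prod_normE/= ge_max h1. Qed.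

Lemma pair_path (T : R) (f : R -> X * Y) :
  continuous_path T (fst \o f) -> continuous_path T (snd \o f) ->
  continuous_path T f.
Proof.
move=> /continuous_pathP c1 /continuous_pathP c2; apply/continuous_pathP.
move=> t tT e e0; have [d1 d10 h1] := c1 t tT e e0.
have [d2 d20 h2] := c2 t tT e e0.
exists (Num.min d1 d2) => [|t' t'T]; first by rewrite lt_min d10.
by rewrite lt_min => /andP[t1 t2]; apply: prod_norm_leP; [exact: h1|exact: h2].
Qed.

Definition inl_fun (a : X) : X * Y := (a, 0).
Definition inr_fun (b : Y) : X * Y := (0, b).

Lemma inl_fun_is_linear : linear inl_fun.
Proof. by move=> k a b; rewrite /inl_fun; congr pair; rewrite /= scaler0 addr0. Qed.
HB.instance Definition _ :=
  GRing.isLinear.Build R X (X * Y)%type _ inl_fun inl_fun_is_linear.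

Lemma inr_fun_is_linear : linear inr_fun.
Proof. by move=> k a b; rewrite /inr_fun; congr pair; rewrite /= scaler0 addr0. Qed.
HB.instance Definition _ :=
  GRing.isLinear.Build R Y (X * Y)%type _ inr_fun inr_fun_is_linear.

Lemma inl_fun_continuous : continuous inl_fun.
Proof.
apply: (@bounded_linear_cts _ _ _ _ 1) => a; rewrite mul1r.
by apply: prod_norm_leP => //=; rewrite normr0.
Qed.

Lemma inr_fun_continuous : continuous inr_fun.
Proof.
apply: (@bounded_linear_cts _ _ _ _ 1) => a; rewrite mul1r.
by apply: prod_norm_leP => //=; rewrite normr0.
Qed.

(** A form on the product is the sum of its restrictions to the two factors, each of which is
    continuous. *)
Lemma weak_integral_pair (f : R -> X * Y) (a b : R) (I : X) (J : Y) :
  weak_integral (fst \o f) a b I -> weak_integral (snd \o f) a b J ->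
  weak_integral f a b (I, J).
Proof.
move=> fI fJ l cl.
have c1 : continuous (l \o inl_fun : {linear X -> R^o}).
  by move=> x; apply: continuous_comp; [exact: inl_fun_continuous|exact: cl].
have c2 : continuous (l \o inr_fun : {linear Y -> R^o}).
  by move=> x; apply: continuous_comp; [exact: inr_fun_continuous|exact: cl].
have lE z : l z = l (inl_fun z.1) + l (inr_fun z.2).
  rewrite -linearD; congr (l _); case: z => x y.
  by rewrite /inl_fun /inr_fun; congr pair; rewrite /= ?addr0 ?add0r.
have [i1 e1] := fI _ c1; have [i2 e2] := fJ _ c2.
split.
  rewrite (_ : (fun u => (l (f u))%:E) =
      (fun u => (l (inl_fun (f u).1))%:E + (l (inr_fun (f u).2))%:E)%E).
    by apply: (integrableD _ i1 i2).
  by apply/funext => u; rewrite lE EFinD.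
under eq_integral do rewrite lE EFinD.
by rewrite lE/= integralD_EFin// EFinD e1 e2.
Qed.

Hypotheses (X_normed : normed_by_forms X) (Y_normed : normed_by_forms Y).

(** As the product carries the maximum norm, a form of norm at most 1 on a factor still has norm at
    most 1 when composed with the projection. *)
Lemma prod_normed_by_forms : normed_by_forms (X * Y)%type.
Proof.
move=> z K K0 zK; apply: prod_norm_leP.
  apply: X_normed => // l cl l1; apply: (zK (l \o fst : {linear (X * Y)%type -> R^o})).
    by move=> x; apply: continuous_comp; [exact: cvg_fst|exact: cl].
  by move=> y; apply: le_trans (l1 _) _; exact: norm_fst_le.
apply: Y_normed => // l cl l1; apply: (zK (l \o snd : {linear (X * Y)%type -> R^o})).
  by move=> x; apply: continuous_comp; [exact: cvg_snd|exact: cl].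
by move=> y; apply: le_trans (l1 _) _; exact: norm_snd_le.
Qed.

End ProductSpace.

(** * Weak integrals of continuous paths in H^s *)

Section SobolevIntegral.
Context {R : realType} {H : completeNormedModType R}
  {ip : {dot H for (@idfun R)}}.
Hypothesis ip_norm : forall x : H, ip x x = `|x| ^+ 2.
Variables (phi : orthobasis ip) (s : R).
Hypothesis s_ge0 : 0 <= s.
Local Notation E := (Hsp phi s).
Local Notation mu := (@lebesgue_measure R).

Lemma coord_form_le (a : nat -> R) N (x : E) :
  `|coord_form (fun j => weight s j * a j) N x| <=
  Num.sqrt (\sum_(0 <= j < N) weight s j * a j ^+ 2) * `|x|.
Proof.
apply: le_trans (Cauchy_Schwarz_sum _ _ _ _) _.
  by move=> j; rewrite ltW// weight_gt0.
rewrite ler_wpM2l// -[leRHS]ger0_norm// -sqrtr_sqr ler_wsqrtr//.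
exact: partial_sqnorm_le.
Qed.

Lemma coord_form_continuous (a : nat -> R) N : continuous (coord_form a N : E -> R^o).
Proof.
apply: (@bounded_linear_cts _ _ _ (coord_form a N)
  (\sum_(0 <= j < N) `|a j| * Num.sqrt (weight s j)^-1)).
move=> x; rewrite mulr_suml; apply: le_trans (ler_norm_sum _ _ _) _.
by apply: ler_sum => j _; rewrite normrM -mulrA ler_wpM2l//; exact: coord_norm_le.
Qed.

Lemma Rintegral_coord_form (a : nat -> R) N (f : R -> E) (t : R) :
  continuous_path t f ->
  \int[mu]_(u in `[0, t]) coord_form a N (f u) =
  \sum_(0 <= j < N) a j * \int[mu]_(u in `[0, t]) coord_fun j (f u).
Proof.
move=> cf; elim: N => [|N ih].
  rewrite big_nil -[RHS](@Rintegral_set0 _ _ _ mu (fun=> 0)) /Rintegral.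
  rewrite integral_set0 integral0_eq// => u _.
  by rewrite /coord_form big_nil.
rewrite big_nat_recr//= -ih.
have i1 : mu.-integrable `[0, t] (EFin \o (fun u => coord_form a N (f u))).
  apply: path_integrable.
  exact: (@linear_path _ _ _ (coord_form a N)) (@coord_form_continuous a N) cf.
have i2 : mu.-integrable `[0, t] (EFin \o (fun u => coord_fun N (f u))).
  apply: path_integrable.
  exact: (@linear_path _ _ _ (coord_fun N)) (@coord_fun_continuous _ _ _ _ N) cf.
have i3 : mu.-integrable `[0, t] (EFin \o (fun u => a N * coord_fun N (f u))).
  by apply: (integrableZl _ (a N) i2).
rewrite -RintegralZl// -RintegralD//.
by apply: eq_Rintegral => u _; rewrite /coord_form big_nat_recr.
Qed.

(** The candidate has as coordinates the integrals [y] of the coordinates of [f]. It remains to see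
    that [y] belongs to H^s, and that the identity extends from finite combinations of coordinates
    to all continuous forms. *)
Lemma exists_weak_integral (f : R -> E) (t : R) : 0 <= t ->
  continuous_path t f -> exists I, weak_integral f 0 t I.
Proof.
move=> t0 cf; have [M M0 fM] := path_bounded cf.
pose y j := \int[mu]_(u in `[0, t]) coord_fun j (f u).
have yM N : \sum_(0 <= j < N) weight s j * y j ^+ 2 <= (M * t) ^+ 2.
  (* [Q] is the integral of the form with coefficients [weight s j * y j], whose norm is at most
     [Num.sqrt Q]; hence [Q <= Num.sqrt Q * (M * t)], and one factor [Num.sqrt Q] cancels. *)
  set Q := \sum_(0 <= j < N) _.
  have Q0 : 0 <= Q by apply: sumr_ge0 => j _; exact: weight_sqr_ge0.
  have cl := @coord_form_continuous (fun j => weight s j * y j) N.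
  have QE : Q = \int[mu]_(u in `[0, t]) coord_form (fun j => weight s j * y j) N (f u).
    rewrite Rintegral_coord_form//; apply: eq_bigr => j _.
    by rewrite expr2 mulrA.
  have iQ : mu.-integrable `[0, t] (EFin \o
      (fun u => coord_form (fun j => weight s j * y j) N (f u))).
    by apply: path_integrable; exact: linear_path cl cf.
  have : `|Q| <= Num.sqrt Q * (M * t).
    rewrite [X in `|X|]QE; apply: le_trans (le_normr_Rintegral _ _) _ => //.
    have muI : mu `[0, t] = t%:E.
      rewrite lebesgue_measure_itv/= lte_fin; case: ltP => [_|t00].
        by rewrite oppr0 adde0.
      by rewrite (_ : t = 0)//; apply/eqP; rewrite eq_le t0 t00.
    have -> : Num.sqrt Q * (M * t) = \int[mu]_(u in `[0, t]) (Num.sqrt Q * M).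
      by rewrite Rintegral_cst// [X in fine X]muI/= mulrA.
    apply: le_Rintegral => //.
    - exact: integrable_abse iQ.
    - exact: (path_integrable (@path_cst _ R^o t (Num.sqrt Q * M))).
    - move=> u ut; apply: le_trans (coord_form_le _ _ _) _.
      by rewrite ler_wpM2l//; exact: fM.
  rewrite ger0_norm// -{1}(sqr_sqrtr Q0) expr2.
  have [q0|q0] := eqVneq (Num.sqrt Q) 0.
    by move=> _; rewrite -(sqr_sqrtr Q0) q0 expr0n/= sqr_ge0.
  have qp : 0 < Num.sqrt Q by rewrite lt_def q0/=.
  rewrite ler_pM2l// => qM; rewrite -(sqr_sqrtr Q0).
  by rewrite ler_pXn2r ?nnegrE// mulr_ge0.
have [I Iy] := exists_sobolev ip_norm phi s_ge0 yM.
exists I => l cl.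
have cl' := linear_path cl cf; have il := path_integrable cl'.
split=> //.
(* The composites of [l] with the truncations [P] are finite combinations of coordinates and
   converge to [l] pointwise. Truncation does not increase the norm, so [K * M] dominates them along
   the path. *)
have [K K0 lK] := cts_linear_bounded cl.
pose e j := l (sob_basis phi s j).
pose P (x : E) := series (fun j => ip (sobolev_val x) (phi j) *: sob_basis phi s j).
have lP (x : E) N : l (P x N) = coord_form e N x.
  rewrite linear_sum; apply: eq_bigr => j _.
  by rewrite linearZ/= mulrC.
have cvgP (x : E) : coord_form e N x @[N --> \oo] --> l x.
  rewrite (_ : (fun N => _) = l \o P x); last by apply/funext => N /=; rewrite lP.
  by apply: continuous_cvg; [exact: cl|exact: cvg_sob_series].
have normP (x : E) N : `|P x N| <= `|x|.
  apply: sobolev_norm_mono => j.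
  rewrite -[X in `|X|]/(coord_fun j (P x N)) -[X in _ <= `|X|]/(coord_fun j x).
  by rewrite coord_sob_series; case: ifP => // _; rewrite normr0.
have in_ N : mu.-integrable `[0, t] (fun u => (coord_form e N (f u))%:E).
  apply: path_integrable.
  exact: (@linear_path _ _ _ (coord_form e N)) (@coord_form_continuous e N) cf.
have [] := @dominated_convergence _ _ R mu `[0, t] _
  (fun N u => (coord_form e N (f u))%:E) (fun u => (l (f u))%:E) (fun=> (K * M)%:E).
- by [].
- by move=> N; exact: (measurable_int mu (in_ N)).
- exact: (measurable_int mu il).
- by apply: aeW => u _; apply/fine_cvgP; split; [exact: nearW|exact: cvgP].
- exact: (path_integrable (@path_cst _ R^o t (K * M))).
- apply: aeW => u N ut; rewrite /= lee_fin -lP.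
  by apply: le_trans (lK _) _; rewrite ler_wpM2l// (le_trans (normP _ _))// fM.
move=> _ _ cvgI.
have : (EFin \o (fun N => coord_form e N I)) @ \oo --> (l I)%:E.
  by apply/fine_cvgP; split; [exact: nearW|exact: cvgP].
rewrite (_ : EFin \o _ = [sequence
    (\int[mu]_(u in `[0%R, t]) (coord_form e n (f u))%:E)%E]_n).
  by move/cvg_unique => h; apply: h cvgI.
apply/funext => N /=; rewrite -[RHS]fineK; last first.
  by apply: integrable_fin_num (in_ N).
rewrite -[fine _]/(\int[mu]_(u in `[0, t]) coord_form e N (f u))%R.
rewrite Rintegral_coord_form//; congr EFin; apply: eq_bigr => j _.
by rewrite [basis_coordinates phi _ j]Iy.
Qed.

End SobolevIntegral.

Section GeometricSequences.
Context {R : realType} {X : normedModType R}.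

(** The bound is the exact sum of the [k] steps; keeping the subtracted term makes the induction
    close. *)
Lemma geometric_dist (u : nat -> X) (B : R) : 0 <= B ->
  (forall n, `|u n.+1 - u n| <= B / 2 ^+ n) ->
  forall n k, `|u n - u (n + k)%N| <= 2 * B / 2 ^+ n - 2 * B / 2 ^+ (n + k).
Proof.
move=> B0 uB n; elim=> [|k ih]; first by rewrite addn0 !subrr normr0.
apply: le_trans (ler_distD (u (n + k)%N) _ _) _.
rewrite addnS; apply: le_trans (lerD ih _) _; first by rewrite distrC.
rewrite exprS invfM le_eqVlt; apply/orP; left; apply/eqP.
by field; rewrite !expf_neq0// pnatr_eq0.
Qed.

Lemma half_expn_small (B e : R) : 0 < e -> exists N, forall n, (N <= n)%N ->
  B / 2 ^+ n <= e.
Proof.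
move=> e0; have : B * 2^-1 ^+ n @[n --> \oo] --> B * 0.
  by apply: (@cvgMl_tmp R); apply: cvg_expr; rewrite ger0_norm ?invf_lt1 ?ltr1n.
rewrite mulr0 => /cvgrPdist_le/(_ _ e0)[N _ hN]; exists N => n Nn.
have := hN n Nn; rewrite sub0r normrN exprVn; apply: le_trans; exact: ler_norm.
Qed.

Lemma geometric_cvg (u : nat -> X) (B : R) : sequentially_complete X -> 0 <= B ->
  (forall n, `|u n.+1 - u n| <= B / 2 ^+ n) ->
  exists x : X, forall n, `|x - u n| <= 2 * B / 2 ^+ n.
Proof.
move=> cX B0 uB.
have uu n m : (n <= m)%N -> `|u n - u m| <= 2 * B / 2 ^+ n.
  move=> nm; have := geometric_dist B0 uB n (m - n); rewrite subnKC//.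
  move/le_trans; apply; rewrite gerBl divr_ge0 ?exprn_ge0// mulr_ge0//.
have [x ux] : exists x : X, u @ \oo --> x.
  apply: cX => e e0; have [N hN] := half_expn_small (2 * B) e0.
  by exists N => n Nn; apply: le_trans (uu _ _ Nn) _; exact: hN.
exists x => n.
have h : `|u m - u n| @[m --> \oo] --> `|x - u n|.
  by apply: cvg_norm; apply: cvgB => //; exact: cvg_cst.
by apply: (cvgr_to_le h); exists n => // m /= nm; rewrite distrC uu.
Qed.

End GeometricSequences.

(** * Picard iteration *)

Section Picard.
Context {R : realType} {X : normedModType R}.
Hypotheses (X_normed : normed_by_forms X) (X_complete : sequentially_complete X).
Hypothesis X_integral : forall (f : R -> X) t, 0 <= t -> continuous_path t f ->
  exists I, weak_integral f 0 t I.
Variables (G : X -> X) (L : R).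
Hypotheses (L_gt0 : 0 < L) (G_lipschitz : forall a b, `|G a - G b| <= L * `|a - b|).

(** The path [w] gathers the initial condition and the transformed noise, so that only the drift
    remains in the fixed-point problem. *)
Definition integral_solution (T : R) (w x : R -> X) : Prop :=
  continuous_path T x /\ forall t, t \in `[0, T] ->
    exists2 I, weak_integral (G \o x) 0 t I & x t = w t + I.

(** With this rate, the factor [L / lam] produced by one application of the drift and one
    integration is 1/2. *)
Let lam := 2 * L.

Let lam_gt0 : 0 < lam. Proof. by rewrite mulr_gt0. Qed.

Let expR_ge1 t : 0 <= t -> 1 <= expR (lam * t).
Proof. by move=> t0; rewrite -[leLHS]expR0 ler_expR mulr_ge0// ltW. Qed.

(* The maximum [K] of [exp (- 2 L t) |x t - y t|] satisfies
   [K e <= delta + (K / 2) (e - 1)] with [e = exp (2 L t)] at a maximum point. *)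
Lemma integral_solution_stable (T delta : R) (w w' x y : R -> X) : 0 <= T ->
  integral_solution T w x -> integral_solution T w' y ->
  (forall t, t \in `[0, T] -> `|w t - w' t| <= delta) ->
  forall t, t \in `[0, T] -> `|x t - y t| <= delta * expR (2 * L * T).
Proof.
move=> T0 [cx xE] [cy yE] ww.
pose h u := `|x u - y u| * expR (- lam * u).
have ch : {within `[0, T], continuous h}.
  move=> u; apply: (@cvgM R).
    by apply: cvg_norm; apply: cvgB; [exact: cx|exact: cy].
  by move: u; apply: continuous_subspaceT; exact: continuous_expRM.
have [c cT hc] := EVT_max T0 ch.
have xyh u : `|x u - y u| = h u * expR (lam * u).
  by rewrite /h -mulrA -expRD mulNr addNr expR0 mulr1.
have K0 : 0 <= h c by rewrite mulr_ge0// expR_ge0.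
have [c0 cleT] : 0 <= c /\ c <= T by move: cT; rewrite in_itv/= => /andP[].
have [I xI xcE] := xE c cT; have [J yJ ycE] := yE c cT.
have hcd : h c <= delta.
  have hle : h c * expR (lam * c) <=
      delta + L * h c / lam * (expR (lam * c) - 1).
    rewrite -xyh xcE ycE opprD addrACA.
    apply: le_trans (ler_normD _ _) _; apply: lerD; first exact: ww.
    apply: (weak_integral_expR_le X_normed lam_gt0 _ c0 xI yJ).
      by rewrite mulr_ge0// ltW.
    move=> u uc; apply: le_trans (G_lipschitz _ _) _.
    rewrite -mulrA ler_wpM2l ?(ltW L_gt0)// xyh ler_wpM2r ?expR_ge0//.
    apply: hc; move: uc; rewrite !in_itv/= => /andP[-> /le_trans]; exact.
  have lamE : L * h c / lam = h c / 2 by rewrite /lam; field; rewrite gt_eqF.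
  have e1 : 0 <= h c * (expR (lam * c) - 1).
    by rewrite mulr_ge0// subr_ge0 expR_ge1.
  (* The inequality rearranges to [K + (K / 2) (e - 1) <= delta], and [K (e - 1)] is nonnegative. *)
  by move: hle e1; rewrite lamE; set e := expR _; lra.
move=> t tT; rewrite xyh; apply: ler_pM.
- by rewrite mulr_ge0// expR_ge0.
- exact: expR_ge0.
- exact: le_trans (hc _ tT) hcd.
- rewrite ler_expR ler_pM2l//; by move: tT; rewrite in_itv/= => /andP[].
Qed.

(** A continuous path is bounded on [[0, T]], so its primitive is Lipschitz. *)
Lemma integral_path (T : R) (f J : R -> X) : continuous_path T f ->
  (forall t, t \in `[0, T] -> weak_integral f 0 t (J t)) -> continuous_path T J.
Proof.
move=> cf fJ; have [M M0 fM] := path_bounded cf.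
have lip t t' : t \in `[0, T] -> t' \in `[0, T] -> t <= t' ->
    `|J t' - J t| <= M * (t' - t).
  move=> tT t'T tt'.
  apply: (weak_integral_lipschitz X_normed M0 _ tt' (fJ t tT) (fJ t' t'T)).
    by move: tT; rewrite in_itv/= => /andP[].
  move=> u ut; apply: fM; move: ut t'T; rewrite !in_itv/= => /andP[-> ut'] /andP[_].
  exact: le_trans.
apply/continuous_pathP => t tT e e0.
have M1 : 0 < M + 1 by rewrite ltr_wpDl.
exists (e / (M + 1)); first by rewrite divr_gt0.
move=> t' t'T tt'; have : `|J t - J t'| <= M * `|t - t'|.
  case: (leP t t') => [|/ltW] tle.
    by rewrite distrC (distrC t) (ger0_norm (_ : 0 <= t' - t)) ?subr_ge0//; exact: lip.
  by rewrite (ger0_norm (_ : 0 <= t - t')) ?subr_ge0//; exact: lip.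
move/le_trans; apply; apply: (@le_trans _ _ ((M + 1) * (e / (M + 1)))).
  by rewrite ler_pM// ?lerDl// ltW.
by rewrite mulrC divfK// gt_eqF.
Qed.

Lemma exists_integral_solution (T : R) (w : R -> X) :
  continuous_path T w -> exists x, integral_solution T w x.
Proof.
move=> cw.
(* The integral is chosen at once for all paths and times, with the arbitrary value 0 where none is
   guaranteed. *)
have /choice[int intP] : forall ft : (R -> X) * R, exists I,
    0 <= ft.2 -> continuous_path ft.2 ft.1 -> weak_integral ft.1 0 ft.2 I.
  move=> [f t]; have [[t0 ct]|h] := pselect (0 <= t /\ continuous_path t f).
    by have [I fI] := X_integral t0 ct; exists I.
  by exists 0 => t0 ct; case: h.
pose x := fix x n : R -> X := if n is n'.+1 then fun t => w t + int (G \o x n', t) else w.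
have cG y : continuous_path T y -> continuous_path T (G \o y).
  exact: lipschitz_path (ltW L_gt0) G_lipschitz.
have intT y t : continuous_path T y -> t \in `[0, T] ->
    weak_integral (G \o y) 0 t (int (G \o y, t)).
  rewrite in_itv/= => cy /andP[t0 tT]; apply: (intP (G \o y, t)) => //.
  by apply: (@continuous_pathW _ _ T) => //; exact: cG.
have cint y : continuous_path T y -> continuous_path T (fun t => int (G \o y, t)).
  by move=> cy; apply: (integral_path (cG _ cy)) => t; exact: intT.
have cx n : continuous_path T (x n).
  by elim: n => [//|n ih]; apply: pathD => //; exact: cint.
have [A A0 hA] := path_bounded (cint _ cw).
(* The iteration starts from [w], so the initial difference is an integral of [G \o w], bounded by
   [A]. Each further integration halves the constant in front of the weight. *)
have step n t : t \in `[0, T] ->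
    `|x n.+1 t - x n t| <= A / 2 ^+ n * expR (lam * t).
  elim: n t => [|n ih] t tT.
    rewrite /= addrAC subrr add0r expr0 divr1.
    apply: le_trans (hA t tT) _; rewrite ler_peMr//.
    by apply: expR_ge1; move: tT; rewrite in_itv/= => /andP[].
  have /andP[t0 tleT] : 0 <= t <= T by move: tT; rewrite in_itv.
  rewrite [x n.+2]/= [x n.+1]/= opprD addrACA subrr add0r.
  apply: le_trans (weak_integral_expR_le X_normed lam_gt0 _ t0
    (intT _ _ (cx n.+1) tT) (intT _ _ (cx n) tT) (A := L * (A / 2 ^+ n)) _) _.
  - by rewrite mulr_ge0 ?(ltW L_gt0)// divr_ge0// exprn_ge0.
  - move=> u ut; apply: le_trans (G_lipschitz _ _) _.
    rewrite -mulrA ler_wpM2l ?(ltW L_gt0)//; apply: ih.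
    by move: ut; rewrite !in_itv/= => /andP[-> /le_trans]; exact.
  rewrite (_ : L * (A / 2 ^+ n) / lam = A / 2 ^+ n.+1); last first.
    by rewrite /lam exprS; field; rewrite expf_neq0//= gt_eqF.
  by rewrite ler_wpM2l ?gerBl// divr_ge0// exprn_ge0.
pose B := A * expR (lam * T).
have B0 : 0 <= B by rewrite mulr_ge0// expR_ge0.
have /choice[y yP] : forall t, exists y, t \in `[0, T] ->
    forall n, `|y - x n t| <= 2 * B / 2 ^+ n.
  move=> t; case: (boolP (t \in `[0, T])) => [tT|_]; last by exists 0.
  have [|y yP] := @geometric_cvg _ _ (x^~ t) B X_complete B0; last by exists y.
  move=> n; apply: le_trans (step n t tT) _.
  rewrite /B mulrAC ler_wpM2r ?invr_ge0 ?exprn_ge0// ler_wpM2l// ler_expR.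
  by rewrite ler_pM2l//; move: tT; rewrite in_itv/= => /andP[].
have cy : continuous_path T y.
  apply: uniform_limit_path => e e0.
  have [N hN] := half_expn_small (2 * B) e0.
  exists (x N) => // t tT; apply: le_trans (yP t tT N) _; exact: hN.
exists y; split=> // t tT; exists (int (G \o y, t)); first exact: intT.
have /andP[t0 tleT] : 0 <= t <= T by move: tT; rewrite in_itv.
(* The defect in the equation for [y] is compared with the exact relation between [x N] and
   [x N.+1]: it is at most [C / 2 ^+ N] for every [N], where [C] collects the distance of [y] to
   [x N.+1] and that of the two integrals. *)
apply/eqP; rewrite -subr_eq0 -normr_le0; apply/ler_addgt0Pl => e e0.
pose C := B + L * B / lam * expR (lam * T) *+ 2.
have [N hN] := half_expn_small C e0; rewrite addr0.
apply: le_trans (hN N (leqnn N)).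
have -> : y t - (w t + int (G \o y, t)) =
    (y t - x N.+1 t) + (int (G \o x N, t) - int (G \o y, t)).
  by rewrite /= !opprD !addrA subrK.
apply: le_trans (ler_normD _ _) _.
have h1 := yP t tT N.+1.
have h2 : `|int (G \o x N, t) - int (G \o y, t)| <=
    L * (2 * B / 2 ^+ N) / lam * (expR (lam * t) - 1).
  apply: (weak_integral_expR_le X_normed lam_gt0 _ t0
    (intT _ _ (cx N) tT) (intT _ _ cy tT)).
    by rewrite mulr_ge0 ?(ltW L_gt0)// divr_ge0 ?exprn_ge0// mulr_ge0.
  move=> u ut.
  have uT : u \in `[0, T].
    by move: ut; rewrite !in_itv/= => /andP[-> /le_trans]; exact.
  (* A uniform bound is available here; the factor [expR (lam * u) >= 1] is inserted to fit the
     weighted estimate. *)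
  apply: le_trans (G_lipschitz _ _) _; rewrite -[leLHS]mulr1.
  apply: ler_pM => //; first by rewrite mulr_ge0// ltW.
    by rewrite ler_pM2l// distrC; exact: yP.
  by apply: expR_ge1; move: uT; rewrite in_itv/= => /andP[].
apply: le_trans (lerD h1 h2) _; rewrite /C [leRHS]mulrDl; apply: lerD.
  rewrite exprS le_eqVlt; apply/orP; left; apply/eqP.
  by field; rewrite expf_neq0//= pnatr_eq0.
rewrite [leRHS](_ : _ = L * (2 * B / 2 ^+ N) / lam * expR (lam * T)); last first.
  by rewrite -mulr_natr; field; rewrite expf_neq0//= gt_eqF.
rewrite ler_wpM2l//.
  by rewrite divr_ge0 ?(ltW lam_gt0)// mulr_ge0 ?(ltW L_gt0)// divr_ge0 ?exprn_ge0// mulr_ge0.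
by rewrite lerBlDr ler_wpDr// ler_expR ler_pM2l.
Qed.

End Picard.

(** * The drift *)

Section MeanValue.
Context {R : realType} {X Y : normedModType R}.

(** For each norming form [l], the real mean value theorem applies to [l \o F] along the segment
    from [y] to [x]. *)
Lemma differential_bound_lipschitz (F : X -> Y) (M : R) : normed_by_forms Y -> 0 <= M ->
  (forall x, differentiable F x) -> (forall x h, `|'d F x h| <= M * `|h|) ->
  forall x y, `|F x - F y| <= M * `|x - y|.
Proof.
move=> Y_normed M0 dF FM x y; apply: Y_normed => [|l cl l1]; first exact: mulr_ge0.
pose p (t : R) : X := y + t *: (x - y).
have dp t : is_diff (t : R^o) (p : R^o -> X) (fun u : R^o => u *: (x - y)).
  rewrite (_ : (fun u : R^o => u *: (x - y)) = 0 + ( *:%R^~ (x - y))); last first.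
    by apply/funext => u; rewrite /= add0r.
  exact: is_diffD.
pose g (t : R) : R := l (F (p t)).
have dl z : is_diff z l l.
  by apply: DiffDef; [exact: linear_differentiable|exact: diff_lin].
have dg (t : R) : is_derive t (1 : R) g (l ('d F (p t) (x - y))).
  have dFp : is_diff (p t) F ('d F (p t)) by exact: DiffDef.
  have h := is_diff_comp (is_diff_comp (dp t) dFp) (dl _).
  have dgt : differentiable (g : R^o -> R^o) t by case: h.
  apply: DeriveDef; first exact/derivable1_diffP.
  rewrite deriveE// (_ : 'd g t = 'd (l \o (F \o p)) t :> (R^o -> R^o))//.
  by case: h => _ ->; rewrite /= scale1r.
have cg : {within `[0, 1], continuous g}.
  apply: continuous_subspaceT => t.
  by apply/differentiable_continuous/derivable1_diffP; case: (dg t).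
have [c _ gE] := MVT ltr01 (fun t _ => dg t) cg.
have -> : l (F x - F y) = l ('d F (p c) (x - y)) :> R.
  rewrite linearB; move: gE; rewrite subr0 mulr1 => <-.
  by rewrite /g /p scale0r scale1r addr0 subrKC.
exact: le_trans (l1 _) (FM _ _).
Qed.

End MeanValue.

Section Drift.
Context {R : realType} {H : completeNormedModType R}
  {ip : {dot H for (@idfun R)}}.
Hypothesis ip_norm : forall x : H, ip x x = `|x| ^+ 2.
Variables (phi : orthobasis ip) (s : R).
Hypothesis s_ge0 : 0 <= s.
Local Notation E := (Hsp phi s).
Variables (lam : nat -> R) (K : R).
Hypotheses (K_ge0 : 0 <= K) (lamK : forall j, weight s j * lam j ^+ 2 <= K).

Lemma weightN j : weight (- s) j * weight s j = 1 :> R.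
Proof.
rewrite /weight -powRD; last by rewrite pnatr_eq0 implybT.
by rewrite mulrN addNr powRr0.
Qed.

(** Since the weights of H^s and H^(-s) are inverse to each other, the left side is the square of
    [weight s j * lam j ^+ 2] times the weighted square of [a] in H^(-s). *)
Lemma weight_cov_le (a : R) j :
  weight s j * (lam j ^+ 2 * a) ^+ 2 <= K ^+ 2 * (weight (- s) j * a ^+ 2).
Proof.
have -> : weight s j * (lam j ^+ 2 * a) ^+ 2 =
    (weight s j * lam j ^+ 2) ^+ 2 * (weight (- s) j * a ^+ 2).
  rewrite -[LHS]mul1r -(weightN j); ring.
rewrite ler_wpM2r ?weight_sqr_ge0// ler_pXn2r ?nnegrE//.
by rewrite weight_sqr_ge0.
Qed.

Lemma partial_sqnorm_cov (y : Hdual R s) N :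
  \sum_(0 <= j < N) weight s j * (lam j ^+ 2 * sobolev_val y j) ^+ 2 <=
  (K * `|y|) ^+ 2.
Proof.
rewrite exprMn; apply: (@le_trans _ _ (K ^+ 2 *
  partial_sqnorm (c := @seq_coordinates R) (r := - s) (sobolev_val y) N)).
  by rewrite mulr_sumr; apply: ler_sum => j _; exact: weight_cov_le.
by rewrite ler_wpM2l ?sqr_ge0//; exact: partial_sqnorm_le.
Qed.

(** [cov_dual] is a limit, informative only if the series converges. A vector with the expected
    coordinates exists by the bound above, and its expansion is the defining series. *)
Lemma coord_cov_dual (y : Hdual R s) j :
  ip (sobolev_val (cov_dual phi lam y)) (phi j) = lam j ^+ 2 * sobolev_val y j.
Proof.
have [x xE] := exists_sobolev ip_norm phi s_ge0 (partial_sqnorm_cov y).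
have := @cvg_sob_series _ _ _ _ _ x.
under [X in series X]eq_fun do rewrite xE.
by move=> /norm_cvg_lim; rewrite -/(cov_dual phi lam y) => ->.
Qed.

Lemma cov_dual_lipschitz (y z : Hdual R s) :
  `|cov_dual phi lam y - cov_dual phi lam z| <= K * `|y - z|.
Proof.
apply: sobolev_norm_le => [|N]; first exact: mulr_ge0.
apply: le_trans (partial_sqnorm_cov (y - z) N); apply: ler_sum => j _.
rewrite -[basis_coordinates phi _ j]/(coord_fun j
  (cov_dual phi lam y - cov_dual phi lam z)).
rewrite linearB/= !coord_funE !coord_cov_dual.
by rewrite -mulrBr; exact: lexx.
Qed.

Variables (DPsi : E -> Hdual R s) (M : R).
Hypotheses (M_ge0 : 0 <= M) (DPsi_diff : forall x, differentiable DPsi x)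
  (D2Psi_bound : forall x h, `|'d DPsi x h| <= M * `|h|).
Variables (G1 G2 : {linear E -> E}).
Hypotheses (G1_cts : continuous G1) (G2_cts : continuous G2).

Lemma drift_lipschitz : exists2 L, 0 < L & forall x y,
  `|drift lam DPsi G1 G2 x - drift lam DPsi G1 G2 y| <= L * `|x - y|.
Proof.
have [K1 K10 G1K] := cts_linear_bounded G1_cts.
have [K2 K20 G2K] := cts_linear_bounded G2_cts.
pose F x := x + cov_dual phi lam (DPsi x); pose LF := 1 + K * M.
have LF0 : 0 <= LF by rewrite addr_ge0// mulr_ge0.
have FL x y : `|F x - F y| <= LF * `|x - y|.
  rewrite /F opprD addrACA (le_trans (ler_normD _ _))// /LF mulrDl mul1r lerD2l.
  apply: le_trans (cov_dual_lipschitz _ _) _; rewrite -mulrA ler_wpM2l//.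
  exact: differential_bound_lipschitz (@sobolev_normed_by_forms _ _ _ _) M_ge0 _ _ x y.
(* The terms [1 + K1 * LF] serve the first component and [LF + K2] the second; the 1 also makes the
   constant positive. *)
clearbody LF; exists (1 + K1 * LF + LF + K2).
  by rewrite -!addrA ltr_pwDl// !addr_ge0// mulr_ge0.
move=> x y; have h1 := norm_fst_le (x - y); have h2 := norm_snd_le (x - y).
have F1 : `|F x.1 - F y.1| <= LF * `|x - y|.
  by apply: le_trans (FL _ _) _; rewrite ler_wpM2l.
have n0 := normr_ge0 (x - y).
have a1 : 0 <= LF * `|x - y| by rewrite mulr_ge0.
have a2 : 0 <= K1 * (LF * `|x - y|) by rewrite mulr_ge0.
have a3 : 0 <= K2 * `|x - y| by rewrite mulr_ge0.
apply: prod_norm_leP => /=.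
  rewrite -/(F x.1) -/(F y.1).
  have -> : x.2 - G1 (F x.1) - (y.2 - G1 (F y.1)) =
      (x - y).2 - G1 (F x.1 - F y.1).
    rewrite (linearB G1)/= !opprB [G1 (F y.1) - y.2]addrC addrACA.
    by rewrite [- _ + G1 _]addrC.
  apply: le_trans (ler_normB _ _) _.
  have g1 : `|G1 (F x.1 - F y.1)| <= K1 * (LF * `|x - y|).
    by apply: le_trans (G1K _) _; rewrite ler_wpM2l.
  apply: le_trans (lerD h2 g1) _.
  rewrite !mulrDl mul1r -[K1 * LF * _]mulrA -!addrA.
  by rewrite !lerD2l lerDl addr_ge0.
rewrite -/(F x.1) -/(F y.1).
have -> : - F x.1 - G2 x.2 - (- F y.1 - G2 y.2) =
    - (F x.1 - F y.1) - G2 ((x - y).2).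
  by rewrite (linearB G2)/= !opprD !opprK addrACA.
apply: le_trans (ler_normB _ _) _; rewrite normrN.
have g2 : `|G2 (x - y).2| <= K2 * `|x - y|.
  by apply: le_trans (G2K _) _; rewrite ler_wpM2l.
apply: le_trans (lerD F1 g2) _.
by rewrite !mulrDl mul1r -[K1 * LF * _]mulrA lerD2r lerDr addr_ge0.
Qed.

End Drift.

(** * Brownian paths *)

Section NormalMoment.
Context {R : realType}.
Local Notation mu := (@lebesgue_measure R).

(** The Radon-Nikodym derivative of the normal law has the same integral as the density on every
    measurable set, so the two agree almost everywhere. *)
Lemma ge0_integral_normal_prob (m sigma : R) (f : R -> R) :
  measurable_fun setT f -> (forall x, 0 <= f x) ->
  (\int[normal_prob m sigma]_x (f x)%:E =
   \int[mu]_x (f x * normal_pdf m sigma x)%:E)%E.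
Proof.
move=> mf f0; have dom := @normal_prob_dominates R m sigma.
have mf' : measurable_fun setT (EFin \o f) by exact/measurable_EFinP.
have RNi := Radon_Nikodym_SigmaFinite.f_integrable dom.
have mpdf : measurable_fun setT (EFin \o normal_pdf m sigma).
  by apply/measurable_EFinP; exact: measurable_normal_pdf.
rewrite -(Radon_Nikodym_SigmaFinite.change_of_variables dom)//.
apply: ae_eq_integral => //.
- by apply: emeasurable_funM => //; exact: (measurable_int mu).
- exact: (emeasurable_funM mf' mpdf).
- under [X in ae_eq _ _ _ X]eq_fun do rewrite EFinM.
  apply: ae_eqe_mul2l; apply: integral_ae_eq => // E _ mE.
  by rewrite -Radon_Nikodym_SigmaFinite.f_integral.
Qed.

(* With [y = x ^ 2 / (4 sigma ^ 2)], the density is a multiple of [exp (- 2 y)],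
   [x ^ 4 <= 32 sigma ^ 4 exp y], and [exp (- y)] is a multiple of the density of
   variance [2 sigma ^ 2]. *)
Lemma normal_fourth_moment (sigma : R) : 0 < sigma ->
  (\int[normal_prob 0 sigma]_x (x ^+ 4)%:E <= (64 * sigma ^+ 4)%:E)%E.
Proof.
move=> s0; have s0' := lt0r_neq0 s0.
have x40 (x : R) : 0 <= x ^+ 4 by rewrite exprn_even_ge0.
have m4 : measurable_fun setT (fun x : R => x ^+ 4) by exact: measurable_funX.
rewrite ge0_integral_normal_prob//.
have t0 : 0 < Num.sqrt 2 * sigma by rewrite mulr_gt0// sqrtr_gt0.
have t0' := lt0r_neq0 t0.
have t2 : (Num.sqrt 2 * sigma) ^+ 2 = 2 * sigma ^+ 2 by rewrite exprMn sqr_sqrtr.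
(* The exact ratio of the two peaks is [Num.sqrt 2]; the cruder factor 2 turns 32 into the final
   64. *)
have peak : normal_peak sigma <= 2 * normal_peak (Num.sqrt 2 * sigma).
  rewrite /normal_peak t2 -[leLHS]invrK invrK -lef_pV2 ?posrE; first last.
  - by rewrite invr_gt0 sqrtr_gt0 pmulrn_lgt0// mulr_gt0 ?pi_gt0// exprn_gt0.
  - by rewrite mulr_gt0// invr_gt0 sqrtr_gt0 pmulrn_lgt0// !mulr_gt0 ?pi_gt0// exprn_gt0.
  rewrite invfM !invrK ler_pdivrMl// -[2 in leRHS](ger0_norm (_ : 0 <= 2))//.
  rewrite -sqrtr_sqr -sqrtrM ?sqr_ge0// ler_wsqrtr//.
  have : 0 <= sigma ^+ 2 * pi :> R by rewrite mulr_ge0 ?pi_ge0// sqr_ge0.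
  rewrite !mulr2n; lra.
have bound x : x ^+ 4 * normal_pdf 0 sigma x <=
    64 * sigma ^+ 4 * normal_pdf 0 (Num.sqrt 2 * sigma) x.
  rewrite !normal_pdfE// /normal_fun subr0.
  pose y := x ^+ 2 / (4 * sigma ^+ 2).
  have y0 : 0 <= y by rewrite divr_ge0 ?sqr_ge0// mulr_ge0 ?sqr_ge0.
  have -> : - x ^+ 2 / (sigma ^+ 2 *+ 2) = - y + - y.
    by rewrite /y; field; rewrite s0'.
  have -> : - x ^+ 2 / ((Num.sqrt 2 * sigma) ^+ 2 *+ 2) = - y.
    by rewrite t2 /y; field; rewrite s0'.
  rewrite expRD.
  have xy : x ^+ 4 = 16 * sigma ^+ 4 * y ^+ 2 by rewrite /y; field; rewrite s0'.
  have ye : y ^+ 2 * expR (- y) <= 2.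
    have := expR_ge1Dxn 1 y0; rewrite expRN ler_pdivrMr ?expR_gt0//.
    have := expR_gt0 y; rewrite /factorial/=; lra.
  have -> : x ^+ 4 * (normal_peak sigma * (expR (- y) * expR (- y))) =
      (16 * sigma ^+ 4 * normal_peak sigma * expR (- y)) * (y ^+ 2 * expR (- y)).
    by rewrite xy; ring.
  apply: (@le_trans _ _ ((16 * sigma ^+ 4 * normal_peak sigma * expR (- y)) * 2)).
    by rewrite ler_wpM2l// !mulr_ge0 ?expR_ge0 ?normal_peak_ge0 ?exprn_ge0// ltW.
  have -> : 16 * sigma ^+ 4 * normal_peak sigma * expR (- y) * 2 =
      32 * sigma ^+ 4 * expR (- y) * normal_peak sigma by ring.
  have -> : 64 * sigma ^+ 4 * (normal_peak (Num.sqrt 2 * sigma) * expR (- y)) =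
      32 * sigma ^+ 4 * expR (- y) * (2 * normal_peak (Num.sqrt 2 * sigma)) by ring.
  by rewrite ler_wpM2l// !mulr_ge0 ?expR_ge0 ?exprn_ge0// ltW.
have mpdf := measurable_normal_pdf (0 : R) (Num.sqrt 2 * sigma).
apply: (@le_trans _ _
  (\int[mu]_x ((64 * sigma ^+ 4)%:E * (normal_pdf 0 (Num.sqrt 2 * sigma) x)%:E))%E).
  apply: ge0_le_integral => //.
  - by move=> x _; rewrite lee_fin mulr_ge0 ?normal_pdf_ge0.
  - apply/measurable_EFinP/measurable_funM => //; exact: measurable_normal_pdf.
  - by apply/measurable_EFinP/measurable_funM.
  - by move=> x _; rewrite -EFinM lee_fin.
rewrite ge0_integralZl_EFin ?integral_normal_pdf ?mule1//.
- by move=> x _; rewrite lee_fin normal_pdf_ge0.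
- exact/measurable_EFinP.
- by rewrite mulr_ge0// exprn_ge0// ltW.
Qed.

End NormalMoment.

Section BrownianIncrements.
Context {d : measure_display} {Omega : measurableType d} {R : realType}.
Variable P : probability Omega R.

Lemma process_measurable (X : R -> Omega -> R) (t : R) :
  is_process X -> 0 <= t -> measurable_fun setT (X t).
Proof.
move=> pX t0; apply: (measurability _ (RGenOpens.measurableE R)).
by move=> _ [_ [a [b ->] <-]]; rewrite setTI; apply: pX => //; exact: interval_open.
Qed.

(** The bound is quadratic in [t - s], because the fourth power of the standard deviation
    [Num.sqrt (t - s)] appears. *)
Lemma brownian_increment_moment (b : R -> Omega -> R) (s t : R) :
  standard_brownian P b -> 0 <= s -> s < t ->
  (\int[P]_w ((b t w - b s w) ^+ 4)%:E <= (64 * (t - s) ^+ 2)%:E)%E.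
Proof.
move=> Bb s0 st; pose D (w : Omega) : measurableTypeR R := b t w - b s w.
have mD : measurable_fun setT D.
  have pb := bm_process Bb.
  by apply: measurable_funB; apply: process_measurable => //; exact/ltW/(le_lt_trans s0).
have m4 : measurable_fun setT (fun x : measurableTypeR R => (x ^+ 4)%:E).
  by apply/measurable_EFinP; exact: measurable_funX.
have sg0 : 0 < Num.sqrt (t - s) by rewrite sqrtr_gt0 subr_gt0.
have -> : (\int[P]_w ((b t w - b s w) ^+ 4)%:E = \int[pushforward P D]_x (x ^+ 4)%:E)%E.
  rewrite ge0_integral_pushforward//.
  by move=> x _; rewrite lee_fin exprn_even_ge0.
rewrite (@eq_measure_integral _ _ _ _ (normal_prob 0 (Num.sqrt (t - s)))).
  apply: le_trans (normal_fourth_moment sg0) _; rewrite lee_fin.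
  by rewrite (_ : 4 = 2 * 2)%N// exprM sqr_sqrtr ?subr_ge0// ltW.
by move=> A mA _; exact: (bm_increment Bb s0 st mA).
Qed.

End BrownianIncrements.

(** * Chaining over dyadic times *)

Section Chaining.
Context {R : realType}.

Definition dyadic (T : R) (n k : nat) : R := T * k%:R / 2 ^+ n.

Lemma dyadic_double (T : R) n k : dyadic T n.+1 k.*2 = dyadic T n k.
Proof.
rewrite /dyadic -muln2 natrM exprS; field.
by rewrite expf_neq0// pnatr_eq0.
Qed.

Lemma dyadic_ge0 (T : R) n k : 0 <= T -> 0 <= dyadic T n k.
Proof. by move=> T0; rewrite /dyadic !mulr_ge0// invr_ge0 exprn_ge0. Qed.

Lemma dyadicS (T : R) n k : dyadic T n k.+1 - dyadic T n k = T / 2 ^+ n.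
Proof. by rewrite /dyadic -natr1 mulrDr mulrDl mulr1 addrC addKr. Qed.

(** The constant [10 * (1 - (9 / 10) ^+ n.+1)] is the sum of [(9 / 10) ^+ i] for [i <= n]. A point
    of level [n.+1] either has level [n] or is one increment of its level away from such a point. *)
Lemma dyadic_bound (T Z : R) (b : R -> R) : b 0 = 0 -> 0 <= Z ->
  (forall n k, (k < 2 ^ n)%N ->
     `|b (dyadic T n k.+1) - b (dyadic T n k)| <= (9 / 10) ^+ n * Z) ->
  forall n k, (k <= 2 ^ n)%N ->
     `|b (dyadic T n k)| <= 10 * (1 - (9 / 10) ^+ n.+1) * Z.
Proof.
move=> b0 Z0 bZ; elim=> [|n ih] k.
  rewrite expn0 leq_eqVlt ltnS leqn0 => /orP[]/eqP ->; last first.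
    by rewrite /dyadic mulr0 mul0r b0 normr0 expr1 !mulr_ge0//; lra.
  have := bZ 0%N 0%N (ltn0Sn _); rewrite {2}/dyadic mulr0 mul0r b0 subr0 => h.
  by apply: le_trans h _; rewrite expr0 expr1; lra.
have a0 : 0 <= (9 / 10 : R) ^+ n.+1 * Z by rewrite mulr_ge0// exprn_ge0.
rewrite -(odd_double_half k) expnS mul2n; move: (k./2) => m.
case: (odd k) => /= kn; last first.
  rewrite add0n dyadic_double; apply: le_trans (ih m _) _.
    by rewrite -leq_double.
  rewrite ler_wpM2r// ler_wpM2l// lerD2l lerN2 [leLHS]exprS.
  by rewrite ler_piMl ?exprn_ge0//; lra.
have hm : (m < 2 ^ n)%N by move: kn; rewrite add1n ltn_double.
have := bZ n.+1 m.*2; rewrite expnS mul2n ltn_double => /(_ hm).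
rewrite dyadic_double add1n => h1; have h2 := ih _ (ltnW hm).
rewrite -[X in `|X|](subrK (b (dyadic T n m))).
apply: le_trans (ler_normD _ _) _; apply: le_trans (lerD h1 h2) _.
rewrite [in leRHS]exprS; set e := (9 / 10) ^+ n.+1; lra.
Qed.

(** Rounding [t] down to a multiple of [T / 2 ^+ n] moves it as little as desired, so continuity
    extends the dyadic bound to all times. *)
Lemma chaining (T Z : R) (b : R -> R) : 0 < T -> b 0 = 0 -> 0 <= Z ->
  continuous_path T (b : R -> R^o) ->
  (forall n k, (k < 2 ^ n)%N ->
     `|b (dyadic T n k.+1) - b (dyadic T n k)| <= (9 / 10) ^+ n * Z) ->
  forall t, t \in `[0, T] -> `|b t| <= 10 * Z.
Proof.
move=> T0 b0 Z0 /continuous_pathP cb bZ t tT.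
have /andP[t0 tleT] : 0 <= t <= T by move: tT; rewrite in_itv.
apply/ler_addgt0Pr => e e0; have [d d0 dP] := cb t tT e e0.
have [n /(_ n (leqnn n)) hn] := half_expn_small T (divr_gt0 d0 (ltr0Sn _ 1)).
have p0 : 0 < (2 : R) ^+ n by rewrite exprn_gt0.
pose r := t / T * 2 ^+ n.
have r0 : 0 <= r by rewrite !mulr_ge0// ?invr_ge0 ltW.
have /andP[kr rk] := truncn_itv r0; set k := Num.truncn r in kr rk.
have rt : t = T * r / 2 ^+ n by rewrite /r; field; rewrite !gt_eqF.
have kt : dyadic T n k <= t.
  by rewrite rt /dyadic ler_pM2r ?invr_gt0// ler_pM2l.
have kn : (k <= 2 ^ n)%N.
  rewrite -(@ler_nat R) natrX (le_trans kr)// /r -[leRHS]mul1r ler_pM2r//.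
  by rewrite ler_pdivrMr// mul1r.
have dist : `|t - dyadic T n k| < d.
  rewrite ger0_norm ?subr_ge0//; apply: le_lt_trans (_ : T / 2 ^+ n < _).
    rewrite -(dyadicS T n k) lerD2r rt /dyadic ler_pM2r ?invr_gt0// ler_pM2l//.
    exact: ltW.
  by apply: le_lt_trans hn _; rewrite gtr_pMr// invf_lt1 ?ltr1n.
have := dP (dyadic T n k) _ dist; rewrite in_itv/= dyadic_ge0 ?(ltW T0)//=.
rewrite (le_trans kt tleT) => /(_ isT) h1.
have h2 := dyadic_bound b0 Z0 bZ kn.
rewrite -[X in `|X|](subrK (b (dyadic T n k))).
apply: le_trans (ler_normD _ _) _; rewrite addrC; apply: lerD => //.
apply: le_trans h2 _; rewrite ler_wpM2r// ler_piMr// gerBl exprn_ge0.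
Qed.

(** The factor is the inverse of the fourth power of [(9 / 10) ^+ n]: a bound [y] on this quantity
    bounds each increment of level [n] by [(9 / 10) ^+ n] times the fourth root of [y]. *)
Definition dyadic_level (T : R) (b : R -> R) (n : nat) : R :=
  (10 / 9) ^+ (4 * n) *
    \sum_(0 <= k < 2 ^ n) (b (dyadic T n k.+1) - b (dyadic T n k)) ^+ 4.

Lemma dyadic_level_ge0 T b n : 0 <= dyadic_level T b n.
Proof.
rewrite mulr_ge0 ?exprn_ge0//.
by apply: sumr_ge0 => k _; rewrite exprn_even_ge0.
Qed.

(** Chaining with the fourth root [Z] of [y] gives the bound 100 times the square root of [y].
    Replacing that root by [1 + y] keeps the bound affine in [y], a quantity whose mean can be
    estimated. *)
Lemma sqr_path_bound (T y : R) (b : R -> R) : 0 < T -> b 0 = 0 ->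
  continuous_path T (b : R -> R^o) ->
  (forall n, dyadic_level T b n <= y) ->
  forall t, t \in `[0, T] -> b t ^+ 2 <= 100 * (1 + y).
Proof.
move=> T0 b0 cb by_ t tT.
have y0 : 0 <= y by apply: le_trans (by_ 0%N); exact: dyadic_level_ge0.
pose Z := Num.sqrt (Num.sqrt y).
have Z4 : Z ^+ 4 = y by rewrite (_ : 4 = 2 * 2)%N// exprM !sqr_sqrtr.
have Z0 : 0 <= Z by exact: sqrtr_ge0.
have hZ n k : (k < 2 ^ n)%N ->
    `|b (dyadic T n k.+1) - b (dyadic T n k)| <= (9 / 10) ^+ n * Z.
  move=> kn; rewrite -(@ler_pXn2r _ 4)// ?nnegrE ?mulr_ge0 ?exprn_ge0 ?Z0//.
  rewrite exprMn Z4 -exprM mulnC.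
  set D := b _ - b _; have -> : `|D| ^+ 4 = D ^+ 4.
    by rewrite (_ : 4 = 2 * 2)%N// !exprM real_normK ?num_real.
  have : (10 / 9) ^+ (4 * n) * D ^+ 4 <= y.
    apply: le_trans (by_ n); rewrite ler_wpM2l ?exprn_ge0//.
    rewrite (bigD1_seq k) ?mem_index_iota ?iota_uniq//= lerDl.
    by apply: sumr_ge0 => i _; rewrite exprn_even_ge0.
  rewrite (_ : 10 / 9 = (9 / 10)^-1 :> R); last by field.
  by rewrite exprVn ler_pdivrMl ?exprn_gt0.
have := chaining T0 b0 Z0 cb hZ tT => h.
have : `|b t| ^+ 2 <= (10 * Z) ^+ 2 by rewrite ler_pXn2r ?nnegrE// mulr_ge0.
rewrite real_normK ?num_real// => /le_trans; apply.
rewrite exprMn -[10 ^+ 2 in leLHS]natrX ler_wpM2l//.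
have -> : Z ^+ 2 = Num.sqrt y by rewrite sqr_sqrtr.
have := sqr_ge0 (Num.sqrt y - 1); rewrite sqrrB sqr_sqrtr// mulr1 expr1n => h2.
have := sqrtr_ge0 y; move: h2; rewrite mulr2n; set q := Num.sqrt y; lra.
Qed.

End Chaining.

Section BrownianPaths.
Context {d : measure_display} {Omega : measurableType d} {R : realType}.
Variable P : probability Omega R.

(** The [2 ^ n] increments have fourth moments at most [64 * (T / 2 ^+ n) ^+ 2]; with the weight,
    the ratio of the geometric bound is 5000/6561, less than 4/5. *)
Lemma brownian_dyadic_level_moment (T : R) (b : R -> Omega -> R) n : 0 < T ->
  standard_brownian P b ->
  (\int[P]_w (dyadic_level T (b ^~ w) n)%:E <= (64 * T ^+ 2 * (4 / 5) ^+ n)%:E)%E.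
Proof.
move=> T0 Bb; have pb := bm_process Bb.
have mb k : measurable_fun setT (b (dyadic T n k)).
  by apply: process_measurable => //; exact/dyadic_ge0/ltW.
have m4 k : measurable_fun setT
    (fun w => ((b (dyadic T n k.+1) w - b (dyadic T n k) w) ^+ 4)%:E).
  by apply/measurable_EFinP/measurable_funX/measurable_funB.
under eq_integral do rewrite EFinM -sumEFin.
have sum0 w : setT w -> (0 <= \sum_(0 <= k < 2 ^ n)
    ((b (dyadic T n k.+1) w - b (dyadic T n k) w) ^+ 4)%:E)%E.
  by move=> _; rewrite sume_ge0// => k _; rewrite lee_fin exprn_even_ge0.
have msum := emeasurable_sum (index_iota 0 (2 ^ n)) m4.
have c0 : 0 <= (10 / 9 : R) ^+ (4 * n) by rewrite exprn_ge0.
rewrite ge0_integralZl_EFin//.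
rewrite ge0_integral_sum//; last first.
  by move=> k w _; rewrite lee_fin exprn_even_ge0.
have step k : (\int[P]_w ((b (dyadic T n k.+1) w - b (dyadic T n k) w) ^+ 4)%:E
    <= (64 * (T / 2 ^+ n) ^+ 2)%:E)%E.
  rewrite -(dyadicS T n k); apply: brownian_increment_moment => //.
    exact/dyadic_ge0/ltW.
  by rewrite -subr_gt0 dyadicS divr_gt0// exprn_gt0.
have a0 : (0 <= ((10 / 9) ^+ (4 * n))%:E :> \bar R)%E by rewrite lee_fin exprn_ge0.
apply: le_trans (lee_wpmul2l a0 (lee_sum _ (fun k _ => step k))) _.
rewrite sumEFin -EFinM lee_fin sumr_const_nat subn0 -[_ *+ (2 ^ n)%N]mulr_natr natrX.
have -> : (10 / 9) ^+ (4 * n) * (64 * (T / 2 ^+ n) ^+ 2 * 2 ^+ n) =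
    64 * T ^+ 2 * (((10 / 9) ^+ 4 / 2) ^+ n).
  rewrite exprM [((10 / 9) ^+ 4 / 2) ^+ n]exprMn exprVn.
  by field; rewrite expf_neq0// pnatr_eq0.
have q0 : 0 <= (10 / 9 : R) ^+ 4 / 2 by rewrite divr_ge0// exprn_ge0.
have q45 : (10 / 9 : R) ^+ 4 / 2 <= 4 / 5.
  by rewrite (_ : (10 / 9 : R) ^+ 4 = 10000 / 6561); [lra|field].
have T2 : 0 <= 64 * T ^+ 2 by rewrite pmulr_rge0// sqr_ge0.
rewrite ler_wpM2l//.
by apply: (@lerXn2r R n ((10 / 9) ^+ 4 / 2) (4 / 5)) => //; rewrite nnegrE// (le_trans q0 q45).
Qed.

Lemma nneseries_geometric_le (K : R) : 0 <= K ->
  (\sum_(0 <= n <oo) (K * (4 / 5) ^+ n)%:E <= (5 * K)%:E)%E.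
Proof.
move=> K0; have t0 n : (0 <= (K * (4 / 5) ^+ n)%:E :> \bar R)%E.
  by rewrite lee_fin mulr_ge0// exprn_ge0.
apply: lime_le; first by apply: is_cvg_nneseries => n _ _; exact: t0.
apply: nearW => N; rewrite sumEFin lee_fin.
suff : \sum_(0 <= n < N) K * (4 / 5) ^+ n <= 5 * K * (1 - (4 / 5) ^+ N).
  have K5 : 0 <= 5 * K by rewrite mulr_ge0.
  by move=> /le_trans; apply; rewrite ler_piMr// gerBl exprn_ge0.
elim: N => [|N ih]; first by rewrite big_nil expr0 subrr mulr0.
rewrite big_nat_recr//=; apply: le_trans (lerD ih (lexx _)) _.
by rewrite exprS le_eqVlt; apply/orP; left; apply/eqP; field.
Qed.

Lemma brownian_series_bound (T : R) (b : nat -> R -> Omega -> R) (c : nat -> R) (C : R) :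
  0 < T -> (forall j, standard_brownian P (b j)) -> (forall j, 0 < c j) ->
  (forall N, \sum_(0 <= j < N) c j <= C) ->
  {ae P, forall w, exists m : nat -> R, exists2 K : R,
    forall N, \sum_(0 <= j < N) c j * m j <= K &
    forall j t, t \in `[0, T] -> b j t w ^+ 2 <= m j}.
Proof.
move=> T0 Bb c0 cC.
pose Y j w := (\sum_(0 <= n <oo) (dyadic_level T (b j ^~ w) n)%:E)%E.
pose S w := (\sum_(0 <= j <oo) (c j)%:E * Y j w)%E.
have lev0 j w n : (0 <= (dyadic_level T (b j ^~ w) n)%:E)%E.
  by rewrite lee_fin dyadic_level_ge0.
have Y0 j w : (0 <= Y j w)%E by apply: nneseries_ge0 => n _ _; exact: lev0.
have cY0 j w : (0 <= (c j)%:E * Y j w)%E by rewrite mule_ge0// lee_fin ltW.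
have mlev j n : measurable_fun setT (fun w => (dyadic_level T (b j ^~ w) n)%:E).
  apply/measurable_EFinP/measurable_funM => //; apply: measurable_sum => k.
  apply/measurable_funX/measurable_funB;
    apply: (process_measurable (bm_process (Bb j))); exact/dyadic_ge0/ltW.
have mY j : measurable_fun setT (Y j).
  by apply: ge0_emeasurable_sum => // n w _ _; exact: lev0.
have mcY j : measurable_fun setT (fun w => ((c j)%:E * Y j w)%E).
  exact: measurable_funeM.
have mS : measurable_fun setT S.
  by apply: ge0_emeasurable_sum => // j w _ _; exact: cY0.
(* The level bounds [64 * T ^+ 2 * (4 / 5) ^+ n] sum to this, independently of [j]. *)
pose K0 := 5 * (64 * T ^+ 2).
have K00 : 0 <= K0 by rewrite 2?pmulr_rge0// sqr_ge0.
have intY j : (\int[P]_w Y j w <= K0%:E)%E.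
  rewrite integral_nneseries//.
  apply: le_trans (nneseries_geometric_le _); last by rewrite mulr_ge0// sqr_ge0.
  apply: lee_nneseries => [n _ _|n _].
    by apply: integral_ge0 => w _; exact: lev0.
  exact: brownian_dyadic_level_moment.
have intS : (\int[P]_w S w <= (C * K0)%:E)%E.
  rewrite integral_nneseries//; apply: lime_le.
    by apply: is_cvg_nneseries => j _ _; apply: integral_ge0 => w _; exact: cY0.
  apply: nearW => N; apply: (@le_trans _ _ (\sum_(0 <= j < N) (c j * K0)%:E)%E).
    apply: lee_sum => j _; rewrite ge0_integralZl_EFin//; last exact: ltW.
    by rewrite EFinM lee_wpmul2l// lee_fin ltW.
  by rewrite sumEFin lee_fin -mulr_suml ler_wpM2r.
have S0 w : (0 <= S w)%E by apply: nneseries_ge0 => j _ _; exact: cY0.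
have iS : P.-integrable setT S.
  apply/integrableP; split=> //; rewrite (eq_integral S).
    exact: (le_lt_trans intS (ltry _)).
  by move=> w _; rewrite gee0_abs.
have aeS := integrable_ae measurableT iS.
have ae0 : {ae P, forall w, forall j, b j 0 w = 0}.
  by apply: ae_foralln => j; exact: bm_start (Bb j).
have aec : {ae P, forall w, forall j, {within `[0, +oo[, continuous (b j ^~ w)}}.
  by apply: ae_foralln => j; exact: bm_continuous (Bb j).
move: aeS ae0 aec; apply: filterS3 => w /(_ I) Sfin b0 bc.
have cYle j : ((c j)%:E * Y j w <= S w)%E.
  apply: le_trans (nneseries_lim_ge j.+1 (fun k _ _ => cY0 k w)).
  by rewrite big_nat_recr//= leeDr// sume_ge0.
(* As [c j] is positive, an infinite [Y j w] would make the sum [S w] infinite. *)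
have Yfin j : Y j w \is a fin_num.
  rewrite ge0_fin_numE// ltey; apply: contraTneq Sfin => Yoo.
  have := cYle j; rewrite Yoo gt0_muley ?lte_fin// leye_eq => /eqP ->.
  by [].
pose y j := fine (Y j w).
have yE j : Y j w = (y j)%:E by rewrite fineK.
exists (fun j => 100 * (1 + y j)); exists (100 * (C + fine (S w))).
  move=> N; rewrite (eq_bigr (fun j => 100 * (c j + c j * y j))); last first.
    by move=> j _; ring.
  rewrite -mulr_sumr ler_wpM2l// big_split/= lerD// -lee_fin fineK// -sumEFin.
  apply: le_trans (nneseries_lim_ge N (fun k _ _ => cY0 k w)).
  by apply: lee_sum => j _; rewrite yE EFinM.
move=> j; apply: sqr_path_bound => //.
  by apply: continuous_subspaceW (bc j) => t /=; rewrite !in_itv/= andbT => /andP[].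
move=> n; rewrite -lee_fin -yE.
apply: le_trans (nneseries_lim_ge n.+1 (fun k _ _ => lev0 j w k)).
by rewrite big_nat_recr//= leeDr// sume_ge0.
Qed.

End BrownianPaths.

(** * Summability of the covariance weights *)

Section PowerSeries.
Context {R : realType}.

Lemma summable_powR (p : R) : 1 < p -> exists2 C : R, 0 <= C &
  forall N, \sum_(0 <= j < N) (j.+1%:R : R) `^ (- p) <= C.
Proof.
move=> p1; pose q : R := 2 `^ (1 - p).
have q0 : 0 <= q by exact: powR_ge0.
have q1 : q < 1.
  rewrite /q -opprB powRN invf_lt1 ?powR_gt0//.
  have h : 1 `^ (p - 1) < 2 `^ (p - 1) :> R.
    by apply: gt0_ltr_powR; rewrite ?subr_gt0 ?nnegrE ?ltr1n.
  by move: h; rewrite powR1.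
have q1' : 0 < 1 - q by rewrite subr_gt0.
pose S N : R := \sum_(0 <= j < N) (j.+1%:R : R) `^ (- p).
have condensed n : S (2 ^ n).-1 <= (1 - q ^+ n) / (1 - q).
  elim: n => [|n ih]; first by rewrite /S big_geq// subrr mul0r.
  have le12 : ((2 ^ n).-1 <= (2 ^ n.+1).-1)%N.
    by rewrite -!subn1 leq_sub2r// leq_exp2l.
  rewrite /S (big_cat_nat (leq0n _) le12)/=.
  apply: (@le_trans _ _ ((1 - q ^+ n) / (1 - q) + q ^+ n)); last first.
    rewrite exprS le_eqVlt; apply/orP; left; apply/eqP; field.
    by rewrite gt_eqF.
  apply: lerD; first exact: ih.
  apply: (@le_trans _ _
    (\sum_((2 ^ n).-1 <= j < (2 ^ n.+1).-1) ((2 ^ n)%:R : R) `^ (- p))).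
    rewrite big_nat [leRHS]big_nat; apply: ler_sum => j /andP[nj _].
    have nj' : (2 ^ n <= j.+1)%N by rewrite -(prednK (expn_gt0 2 n)).
    rewrite !powRN lef_pV2 ?posrE ?powR_gt0 ?ltr0n ?expn_gt0//.
    apply: ge0_ler_powR; rewrite ?nnegrE ?ler0n ?ler_nat//.
    exact/ltW/(lt_trans ltr01).
  rewrite sumr_const_nat.
  have -> : ((2 ^ n.+1).-1 - (2 ^ n).-1 = 2 ^ n)%N.
    have := expn_gt0 2 n; rewrite expnS; lia.
  have pn : 0 < (2 ^ n)%:R :> R by rewrite ltr0n expn_gt0.
  rewrite -[_ *+ (2 ^ n)%N]mulr_natl -{1}[(2 ^ n)%:R]powRr1 ?ler0n//.
  rewrite -powRD; last by rewrite (lt0r_neq0 pn) implybT.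
  by rewrite natrX -powR_mulrn// -powRrM mulrC powRrM powR_mulrn// powR_ge0.
exists (1 / (1 - q)); first by rewrite divr_ge0// ltW.
move=> N; have NN : (N <= (2 ^ N).-1)%N.
  by have := ltn_expl N (ltnSn 1); lia.
apply: (@le_trans _ _ (S (2 ^ N).-1)).
  rewrite /S (big_cat_nat (leq0n _) NN)/= lerDl.
  by apply: sumr_ge0 => j _; exact: powR_ge0.
apply: le_trans (condensed N) _; rewrite ler_wpM2r ?invr_ge0 ?(ltW q1')//.
by rewrite gerBl exprn_ge0.
Qed.

End PowerSeries.

Section CovarianceWeights.
Context {R : realType}.
Variables (s kappa M : R) (lam : nat -> R).
Hypotheses (s_lt : s < kappa - 1 / 2) (lam_gt0 : forall j, 0 < lam j).
Hypothesis lam_le : forall j, lam j <= M * j.+1%:R `^ (- kappa).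

Lemma weight_lam_le j :
  weight s j * lam j ^+ 2 <= M ^+ 2 * j.+1%:R `^ (- (2 * (kappa - s))).
Proof.
have l0 := lam_gt0 j.
have p0 : 0 < (j.+1%:R : R) `^ (- kappa) by rewrite powR_gt0.
apply: (@le_trans _ _ (weight s j * (M * j.+1%:R `^ (- kappa)) ^+ 2)).
  rewrite ler_wpM2l ?(ltW (weight_gt0 _))// ler_pXn2r ?nnegrE ?(ltW l0)//.
  by rewrite (le_trans (ltW l0)).
rewrite exprMn mulrCA ler_wpM2l ?sqr_ge0// /weight.
rewrite -[(_ `^ (- kappa)) ^+ 2]powR_mulrn ?powR_ge0// -powRrM -powRD; last first.
  by rewrite pnatr_eq0 implybT.
by rewrite le_eqVlt; apply/orP; left; apply/eqP; congr (_ `^ _); ring.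
Qed.

Lemma weight_lam_bounded j : weight s j * lam j ^+ 2 <= M ^+ 2.
Proof.
apply: le_trans (weight_lam_le j) _; rewrite ler_piMr ?sqr_ge0//.
rewrite -[leRHS](powRr0 (j.+1%:R : R)) ler_powR ?ler1n//.
by have h := s_lt; rewrite oppr_le0 mulr_ge0// subr_ge0; lra.
Qed.

(** The decay exponent [2 * (kappa - s)] exceeds 1, by [s < kappa - 1 / 2]. *)
Lemma weight_lam_summable : exists2 C : R, 0 <= C &
  forall N, \sum_(0 <= j < N) weight s j * lam j ^+ 2 <= C.
Proof.
have [|C C0 hC] := @summable_powR R (2 * (kappa - s)).
  by have h := s_lt; lra.
exists (M ^+ 2 * C) => [|N]; first by rewrite mulr_ge0 ?sqr_ge0.
apply: (@le_trans _ _ (\sum_(0 <= j < N) M ^+ 2 * j.+1%:R `^ (- (2 * (kappa - s))))).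
  by apply: ler_sum => j _; exact: weight_lam_le.
by rewrite -mulr_sumr ler_wpM2l ?sqr_ge0.
Qed.

End CovarianceWeights.

Section SobolevBrownian.
Context {R : realType} {H : completeNormedModType R}
  {ip : {dot H for (@idfun R)}}.
Hypothesis ip_norm : forall x : H, ip x x = `|x| ^+ 2.
Variables (phi : orthobasis ip) (s : R).
Hypothesis s_ge0 : 0 <= s.
Local Notation E := (Hsp phi s).

(* The remainders of the series are dominated, uniformly in time, by those of
   the expansion of the vector of coefficients [Num.sqrt (m j)]. *)
Lemma dominated_series_path (T K : R) (a : nat -> R -> R) (m : nat -> R) (B : R -> E) :
  (forall j, continuous_path T (a j : R -> R^o)) ->
  (forall j t, t \in `[0, T] -> a j t ^+ 2 <= m j) ->
  (forall N, \sum_(0 <= j < N) weight s j * m j <= K) ->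
  (forall t, t \in `[0, T] ->
     series (fun j => a j t *: sob_basis phi s j) @ \oo --> B t) ->
  continuous_path T B.
Proof.
move=> ca am mK aB.
have [T0|T0] := ltP T 0.
  apply/continuous_pathP => t; rewrite in_itv/= => /andP[/le_trans h /h].
  by rewrite leNgt T0.
have T0T : 0 \in `[0, T] by rewrite in_itv/= lexx.
have m0 j : 0 <= m j by apply: le_trans (am j 0 T0T); exact: sqr_ge0.
have [D DE] : exists D : E, forall j, ip (sobolev_val D) (phi j) = Num.sqrt (m j).
  apply: (@exists_sobolev _ _ _ ip_norm phi s s_ge0 _ K) => N.
  by apply: le_trans (mK N); apply: ler_sum => j _; rewrite sqr_sqrtr.
pose S t := series (fun j => a j t *: sob_basis phi s j).
pose SD := series (fun j => Num.sqrt (m j) *: sob_basis phi s j).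
have cSD : SD @ \oo --> D.
  have := @cvg_sob_series _ _ _ _ _ D.
  by under [X in series X]eq_fun do rewrite DE.
have cS N : continuous_path T (fun t => S t N).
  elim: N => [|N ih].
    rewrite (_ : (fun t => _) = fun=> 0); first exact: path_cst.
    by apply/funext => t; rewrite /S /series/= big_nil.
  rewrite (_ : (fun t => _) = fun t => S t N + a N t *: sob_basis phi s N); last first.
    by apply/funext => t; rewrite /S /series/= big_nat_recr.
  apply: pathD => // t; apply: cvgZr_tmp; exact: ca.
apply: uniform_limit_path => e e0.
have /cvgrPdist_le/(_ e e0)[N _ hN] := cSD.
exists (fun t => S t N) => // t tT; apply: le_trans (hN N (leqnn N)).
apply: sobolev_norm_mono => j.
rewrite -[X in `|X|]/(coord_fun j (B t - S t N)).
rewrite -[X in _ <= `|X|]/(coord_fun j (D - SD N)).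
rewrite !linearB/= !coord_sob_series !coord_funE DE.
rewrite (coord_cvg_sob_series (aB t tT)).
case: ifP => _; first by rewrite !subrr.
rewrite !subr0 [leRHS]ger0_norm// -sqrtr_sqr ler_wsqrtr//; exact: am.
Qed.

(** The scalar bounds are summed against [weight s j * lam j ^+ 2], so the squared coefficients of
    [B] are dominated by [lam j ^+ 2 * m j] uniformly in time. The value at time 0 is recorded for
    the initial condition of the solution. *)
Lemma Cs_brownian_path (d : measure_display) (Omega : measurableType d)
    (P : probability Omega R) (lam : nat -> R) (C T : R) (B : R -> Omega -> E) :
  0 < T -> (forall j, 0 < lam j) ->
  (forall N, \sum_(0 <= j < N) weight s j * lam j ^+ 2 <= C) ->
  Cs_brownian P lam B ->
  {ae P, forall w, B 0 w = 0 /\ continuous_path T (B ^~ w)}.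
Proof.
move=> T0 lam0 lamC [_ [b [Bb _ aeB]]].
have c0 j : 0 < weight s j * lam j ^+ 2 by rewrite mulr_gt0 ?weight_gt0 ?exprn_gt0.
have aem := brownian_series_bound T0 Bb c0 lamC.
have ae0 : {ae P, forall w, forall j, b j 0 w = 0}.
  by apply: ae_foralln => j; exact: bm_start (Bb j).
have aec : {ae P, forall w, forall j, {within `[0, +oo[, continuous (b j ^~ w)}}.
  by apply: ae_foralln => j; exact: bm_continuous (Bb j).
have ae0c : {ae P, forall w, (forall j, b j 0 w = 0) /\
    (forall j, {within `[0, +oo[, continuous (b j ^~ w)})}.
  by move: ae0 aec; apply: filterS2.
move: aeB aem ae0c; apply: filterS3 => w Bw [m [K mK bm]] [b0 bc].
split.
  have /norm_cvg_lim <- := Bw 0 (lexx 0).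
  rewrite (_ : series _ = fun=> 0); first exact: norm_cvg_lim (cvg_cst _).
  apply/funext => N; rewrite /series/= big1// => j _.
  by rewrite b0 mulr0 scale0r.
apply: (@dominated_series_path T K (fun j t => lam j * b j t w)
  (fun j => lam j ^+ 2 * m j)).
- move=> j t; apply: (@cvgMl_tmp R).
  have : continuous_path T (b j ^~ w).
    by apply: continuous_subspaceW (bc j) => u /=; rewrite !in_itv/= andbT => /andP[].
  exact.
- by move=> j t tT; rewrite exprMn ler_wpM2l ?sqr_ge0// bm.
- by move=> N; under eq_bigr do rewrite mulrA; exact: mK.
- by move=> t; rewrite in_itv/= => /andP[t0 _]; exact: Bw.
Qed.

End SobolevBrownian.

(** * The Ito map *)

Section SupDistance.
Context {R : realType} {X : normedModType R}.

Lemma norm_le_prod_norm (z : X * X) : `|z| <= prod_norm z.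
Proof.
apply: prod_norm_leP; rewrite -[leLHS]ger0_norm// -sqrtr_sqr ler_wsqrtr//.
  by rewrite lerDl sqr_ge0.
by rewrite lerDr sqr_ge0.
Qed.

Lemma prod_norm_le_norm (z : X * X) : prod_norm z <= 2 * `|z|.
Proof.
have n0 := normr_ge0 z.
have sq (a : X) : `|a| <= `|z| -> `|a| ^+ 2 <= `|z| ^+ 2.
  by move=> az; rewrite ler_pXn2r ?nnegrE.
have h1 := sq _ (norm_fst_le z); have h2 := sq _ (norm_snd_le z).
rewrite -[leRHS]ger0_norm ?mulr_ge0// -sqrtr_sqr ler_wsqrtr// exprMn.
by apply: le_trans (lerD h1 h2) _; have := sqr_ge0 `|z|; lra.
Qed.

(** Continuity on a compact interval makes the set of distances bounded, as is required for its
    supremum to be an upper bound. *)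
Lemma prod_norm_le_sup_dist (T : R) (x y : R -> X * X) :
  continuous_path T x -> continuous_path T y ->
  forall t, t \in `[0, T] -> prod_norm (x t - y t) <= sup_dist T x y.
Proof.
move=> cx cy t tT; apply: ub_le_sup; last by exists t.
have [M1 M10 xM] := path_bounded cx; have [M2 M20 yM] := path_bounded cy.
exists (2 * (M1 + M2)) => _ [u uT <-].
apply: le_trans (prod_norm_le_norm _) _; rewrite ler_wpM2l//.
by apply: le_trans (ler_normB _ _) _; rewrite lerD ?xM ?yM.
Qed.

Lemma sup_dist_le (T K : R) (x y : R -> X * X) : 0 <= T ->
  (forall t, t \in `[0, T] -> prod_norm (x t - y t) <= K) ->
  sup_dist T x y <= K.
Proof.
move=> T0 xyK; apply: ge_sup; last by move=> _ [t tT <-]; exact: xyK.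
by exists (prod_norm (x 0 - y 0)); exists 0 => //=; rewrite in_itv/= lexx.
Qed.

Lemma weak_integral_point (f : R -> X) (a : R) (I : X) :
  normed_by_forms X -> weak_integral f a a I -> I = 0.
Proof.
move=> X_normed fI; apply/eqP; rewrite -normr_le0; apply: X_normed => // l cl _.
by rewrite (weak_integralE cl fI) set_itv1 Rintegral_set1 normr0.
Qed.

End SupDistance.

Theorem theorem4p1
  (R : realType) (H : completeNormedModType R) (ip : {dot H for (@idfun R)})
  (ip_norm : forall x : H, ip x x = `|x| ^+ 2)
  (phi : orthobasis ip)
  (C : {linear H -> H}) (lam : nat -> R)
  (C_trace : positive_trace_class phi C)
  (C_phi : forall j, C (phi j) = lam j ^+ 2 *: phi j)
  (* A1 *)
  (kappa : R) (kappa_gt : 1 / 2 < kappa)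
  (lam_asymp : exists m M : R, [/\ 0 < m, 0 < M & forall j,
     m * j.+1%:R `^ (- kappa) <= lam j <= M * j.+1%:R `^ (- kappa)])
  (* A2 *)
  (s : R) (s_range : 0 <= s < kappa - 1 / 2)
  (Psi : Hsp phi s -> R)
  (* A3 *)
  (Psi_ge0 : forall x, 0 <= Psi x)
  (Psi_growth : exists M : R, forall x, Psi x <= M * (1 + `|x| ^+ 2))
  (* A4 *)
  (DPsi : Hsp phi s -> Hdual R s)
  (Psi_diff : forall x, differentiable Psi x)
  (Psi_diffE : forall x h, 'd Psi x h = dual_pairing (DPsi x) h)
  (DPsi_growth : exists M : R, forall x, `|DPsi x| <= M * (1 + `|x|))
  (DPsi_diff : forall x, differentiable DPsi x)
  (D2Psi_bound : exists M : R, forall x h, `|'d DPsi x h| <= M * `|h|)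
  (* A5 *)
  (Gamma1 Gamma2 : {linear Hsp phi s -> Hsp phi s})
  (Gamma1_bounded : continuous Gamma1) (Gamma2_bounded : continuous Gamma2)
  (Gamma1_comm : commutes_with C Gamma1) (Gamma2_comm : commutes_with C Gamma2)
  (* S1 and S2 are the square roots of 2 Gamma1 and 2 Gamma2 *)
  (S1 S2 : {linear Hsp phi s -> Hsp phi s})
  (S1_bounded : continuous S1) (S2_bounded : continuous S2)
  (S1_sqrt : is_sqrt S1 (fun x => 2 *: Gamma1 x))
  (S2_sqrt : is_sqrt S2 (fun x => 2 *: Gamma2 x))
  (x0 : Hsp phi s * Hsp phi s) (T : R) (T_gt0 : 0 < T) :
  let solves := is_solution (drift lam DPsi Gamma1 Gamma2)
                  (fun w => (S1 w.1, S2 w.2)) x0 in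
  (forall (d : measure_display) (Omega : measurableType d)
      (P : probability Omega R) (B : R -> Omega -> Hsp phi s * Hsp phi s),
    Cs_brownian_pair P lam B ->
    {ae P, forall w, exists x, [/\ solves (B ^~ w) T x, x 0 = x0 &
       forall y, solves (B ^~ w) T y -> {in `[0, T], y =1 x}]}) /\
  (exists Ito : (R -> Hsp phi s * Hsp phi s) -> (R -> Hsp phi s * Hsp phi s),
    (forall W, continuous_path T W ->
       solves W T (Ito W) /\
       forall y, solves W T y -> {in `[0, T], y =1 Ito W}) /\
    exists2 L : R, 0 <= L & forall W W',
      continuous_path T W -> continuous_path T W' ->
      sup_dist T (Ito W) (Ito W') <= L * sup_dist T W W').
Proof.
move=> solves; have T0 := ltW T_gt0.
have [m [M [m0 M0 lamE]]] := lam_asymp.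
have /andP[s0 s_lt] := s_range.
have lam0 j : 0 < lam j.
  have /andP[h _] := lamE j; apply: lt_le_trans h.
  by rewrite mulr_gt0// powR_gt0.
have lam_le j : lam j <= M * j.+1%:R `^ (- kappa) by have /andP[] := lamE j.
have [C0 _ lamC] := weight_lam_summable s_lt lam0 lam_le.
have lamM := weight_lam_bounded s_lt lam0 lam_le.
have [D hD] := D2Psi_bound.
(* The sign of [D] is not prescribed; its absolute value gives a nonnegative constant. *)
have hD' x h : `|'d DPsi x h| <= `|D| * `|h|.
  by apply: le_trans (hD x h) _; rewrite ler_wpM2r// ler_norm.
have [L L0 GL] := drift_lipschitz ip_norm s0 (sqr_ge0 M) lamM (normr_ge0 D)
  DPsi_diff hD' Gamma1_bounded Gamma2_bounded.
pose G := drift lam DPsi Gamma1 Gamma2; rewrite -/G in GL.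
set X := (Hsp phi s * Hsp phi s)%type.
have E_normed : normed_by_forms (Hsp phi s) by exact: sobolev_normed_by_forms.
have X_normed : normed_by_forms X by exact: prod_normed_by_forms.
have X_complete : sequentially_complete X.
  by apply: prod_sequentially_complete; exact: sobolev_complete.
have X_integral (f : R -> X) t : 0 <= t -> continuous_path t f ->
    exists I, weak_integral f 0 t I.
  move=> t0 cf.
  have [I fI] : exists I, weak_integral (fst \o f) 0 t I.
    apply: exists_weak_integral => //.
    apply: (lipschitz_path ler01) cf => a b; rewrite mul1r.
    exact: (norm_fst_le (a - b)).
  have [J fJ] : exists J, weak_integral (snd \o f) 0 t J.
    apply: exists_weak_integral => //.
    apply: (lipschitz_path ler01) cf => a b; rewrite mul1r.
    exact: (norm_snd_le (a - b)).
  by exists (I, J); exact: weak_integral_pair.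
pose S (w : X) : X := (S1 w.1, S2 w.2).
have [K1 K10 S1K] := cts_linear_bounded S1_bounded.
have [K2 K20 S2K] := cts_linear_bounded S2_bounded.
have K0 : 0 <= K1 + K2 by rewrite addr_ge0.
have SK (a b : X) : `|S a - S b| <= (K1 + K2) * `|a - b|.
  apply: prod_norm_leP; rewrite /= -linearB.
    apply: le_trans (S1K _) _; apply: ler_pM => //; first by rewrite lerDl.
    exact: (norm_fst_le (a - b)).
  apply: le_trans (S2K _) _; apply: ler_pM => //; first by rewrite lerDr.
  exact: (norm_snd_le (a - b)).
pose drive (W : R -> X) t := x0 + S (W t).
have solvesE W x : solves W T x <-> integral_solution G T (drive W) x.
  split=> -[cx xE]; split=> // t tT; have [I xI ->] := xE t tT; exists I => //.
    by rewrite /drive addrAC.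
  by rewrite /drive addrAC.
have drive_path W : continuous_path T W -> continuous_path T (drive W).
  move=> cW; apply: pathD; first exact: path_cst.
  exact: lipschitz_path K0 SK cW.
(* The initial condition cancels in the difference of the two driving terms, leaving [S], which is
   Lipschitz with constant [K1 + K2]. *)
have stable W W' x y : continuous_path T W -> continuous_path T W' ->
    solves W T x -> solves W' T y -> forall t, t \in `[0, T] ->
    `|x t - y t| <= (K1 + K2) * sup_dist T W W' * expR (2 * L * T).
  move=> cW cW' /solvesE sx /solvesE sy.
  apply: (integral_solution_stable X_normed L0 GL T0 sx sy) => t tT.
  rewrite /drive opprD addrACA subrr add0r; apply: le_trans (SK _ _) _.
  rewrite ler_wpM2l//; apply: le_trans (norm_le_prod_norm _) _.
  exact: prod_norm_le_sup_dist.
(* Stability with [delta = 0]. *)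
have unique W x y : solves W T x -> solves W T y -> {in `[0, T], y =1 x}.
  move=> /solvesE sx /solvesE sy t tT.
  apply/eqP; rewrite -subr_eq0 -normr_le0 -(mul0r (expR (2 * L * T))).
  apply: (integral_solution_stable X_normed L0 GL T0 sy sx) => // u _.
  by rewrite subrr normr0.
have existence W : continuous_path T W -> exists x, solves W T x.
  move=> /drive_path cW.
  have [x sx] := exists_integral_solution X_normed X_complete X_integral L0 GL cW.
  by exists x; apply/solvesE.
split.
  move=> d Omega P B [B1 B2 _].
  have ae1 := Cs_brownian_path ip_norm s0 T_gt0 lam0 lamC B1.
  have ae2 := Cs_brownian_path ip_norm s0 T_gt0 lam0 lamC B2.
  move: ae1 ae2; apply: filterS2 => w [B10 cB1] [B20 cB2].
  have cB : continuous_path T (B ^~ w) by exact: pair_path.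
  have [x sx] := existence _ cB; exists x; split=> //; last first.
    by move=> y; exact: unique.
  have T00 : 0 \in `[0, T] by rewrite in_itv/= lexx.
  (* At time 0 both the integral over a point and the Brownian motion vanish, leaving [x0]. *)
  have [_ /(_ 0 T00)[I xI ->]] := sx.
  rewrite (weak_integral_point X_normed xI) addr0 B10 B20 !linear0.
  exact: addr0.
(* The map is total; on discontinuous driving paths it takes the arbitrary value 0. *)
have /choice[Ito ItoP] : forall W, exists x, continuous_path T W -> solves W T x.
  move=> W; have [cW|ncW] := pselect (continuous_path T W).
    by have [x sx] := existence W cW; exists x.
  by exists (fun=> 0) => /ncW.
exists Ito; split.
  by move=> W cW; split; [exact: ItoP|move=> y; apply: unique; exact: ItoP].
(* The exponential comes from stability, [K1 + K2] from [S], and 2 from comparing [prod_norm] with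
   the maximum norm on the solutions. *)
exists (2 * (K1 + K2) * expR (2 * L * T)).
  by rewrite !mulr_ge0// expR_ge0.
move=> W W' cW cW'; apply: sup_dist_le => // t tT.
apply: le_trans (prod_norm_le_norm _) _.
have := stable W W' _ _ cW cW' (ItoP W cW) (ItoP W' cW') t tT.
set A := sup_dist T W W' => h.
have -> : 2 * (K1 + K2) * expR (2 * L * T) * A =
    2 * ((K1 + K2) * A * expR (2 * L * T)) by ring.
by rewrite ler_wpM2l.
Qed.
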